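(* Let $n\geq 1$, let $J$ be an open real interval, and let $c_0,\ldots,c_n$ be $C^1$ (complex-valued) functions on $J$, with $c_0$ real-valued and $c_{-j}=\overline{c_j}$. Suppose that $C_{n+1}(t)=(c_{r-s}(t))_{r,s=0}^n$ is positive definite for every $t\in J$. Let $Q_n(\cdot;t)$ be the monic orthogonal polynomial of degree $n$ for these data (see context), let $b:J\to\{z\in\mathbb C:|z|=1\}$ be $C^1$, and set $$P(z;t)=zQ_n(z;t)-\overline{b(t)}\,Q_n^*(z;t),\quad \mathcal L_t[z^j]=c_{-j}(t),\quad |j|\leq n.$$ Every zero of $P$ has a $C^1$ parametrisation on $J$ and a real $C^1$ argument. Write $b=e^{i\beta}$ with a real $C^1$ function $\beta$, and set $\nu(t)=\mathcal L_t[|Q_n(\cdot;t)|^2]$. For a zero branch $\xi=e^{i\theta_\xi}$, define $$h_\xi(t)=\mathcal L_t\left[\left|\frac{P(z;t)}{z-\xi(t)}\right|^2\right]>0,$$ $$V_\xi(z;t)=2\nu(t)\,\Im\left(\frac{Q_n(z;t)K_{n-1}(z,\xi(t);t)}{Q_n(\xi(t);t)}\right),\quad |z|=1,$$ where $K_{n-1}(w,z;t)=\sum_{m=0}^{n-1}\overline{q_m(w;t)}\,q_m(z;t)$. Then $V_\xi(\cdot;t)\in\Lambda_n$ is real-valued on the unit circle, and on $J$ $$h_\xi\theta_\xi'=-\nu\beta'+\dot{\mathcal L}_t[V_\xi].$$ For two distinct zero branches $\zeta=e^{i\varphi}$ and $\eta=e^{i\psi}$, define $$B_{\zeta,\eta}(z;t)=i(\zeta(t)-\eta(t))\frac{z|P(z;t)|^2}{(z-\zeta(t))(z-\eta(t))},\quad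 |z|=1.$$ Then $B_{\zeta,\eta}(\cdot;t)$ is a Laurent polynomial in $\Lambda_n$, real-valued on the unit circle, and $$h_\zeta\varphi'-h_\eta\psi'=\dot{\mathcal L}_t[B_{\zeta,\eta}].$$ For a Laurent polynomial $F=\sum_{j=-n}^n f_jz^j$ that is real-valued on the unit circle, the derivative is explicitly $$\dot{\mathcal L}_t[F]=f_0c_0'(t)+2\Re\sum_{j=1}^n\overline{f_j}\,c_j'(t).$$ In particular, if only $c_{\pm k}$ vary (all other moments being constant in $t$), where $0\leq k\leq n$, then $$\dot{\mathcal L}_t[F]=(2-\delta_{k0})\Re(\overline{f_k}\,c_k'),$$ where $\delta_{k0}=1$ if $k=0$ and $0$ otherwise.
   Context: $\Lambda_n=\operatorname{span}\{z^j:-n\leq j\leq n\}$. Conjugation of polynomials is taken on the unit circle (so $\overline z=z^{-1}$ there); thus expressions such as $\overline f g$, $|f|^2$ or $\Im(\cdot)$ on $|z|=1$ are identified with Laurent polynomials. The functional $\mathcal L_t$ is extended linearly to $\Lambda_n$, and $\langle f,g\rangle_t=\mathcal L_t[\overline f g]$ for polynomials $f,g$ of degree at most $n$, so that $C_{n+1}(t)$ is the Gram matrix of $1,z,\ldots,z^n$. The linear functional $\dot{\mathcal L}_t$ on $\Lambda_n$ is given by $\dot{\mathcal L}_t[z^j]=c_{-j}'(t)$, i.e. only the moments are differentiated and the Laurent-polynomial argument is held fixed (at its value at $t$). Primes on functions of $t$ denote $d/dt$. For $0\leq m\leq n$, $Q_m(\cdot;t)$ is the monic polynomial of degree $m$ orthogonal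 to $1,z,\ldots,z^{m-1}$ with respect to $\langle\cdot,\cdot\rangle_t$ (with $Q_0=1$); for $1\leq m\leq n$, with $C_m=(c_{r-s})_{r,s=0}^{m-1}$, explicitly $$Q_m(z)=\frac{1}{\det C_m}\det\begin{pmatrix} c_0&c_{-1}&\cdots&c_{-m}\\ c_1&c_0&\cdots&c_{1-m}\\ \vdots&\vdots&&\vdots\\ c_{m-1}&c_{m-2}&\cdots&c_{-1}\\ 1&z&\cdots&z^m\end{pmatrix}.$$ Moreover $q_m=\kappa_mQ_m$ with $\kappa_m=\mathcal L_t[|Q_m|^2]^{-1/2}>0$ (so $\nu=\kappa_n^{-2}$), and $Q_n^*(z;t)=z^n\overline{Q_n(1/\overline z;t)}$, with value at $z=0$ by polynomial continuation. The polynomial $P(\cdot;t)$ is monic with $n+1$ simple zeros, all on the unit circle, and the zeros of $Q_n(\cdot;t)$ lie in the open unit disc. A zero branch is a $C^1$ function $\xi:J\to\{|z|=1\}$ with $P(\xi(t);t)=0$ for all $t\in J$. Apparent singularities in the quotients (at $z=\xi,\zeta,\eta$) are removable, and the expressions are understood through their polynomial quotients. *)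

(* Defs.v *)
From mathcomp Require Import all_boot all_order all_algebra.
From mathcomp Require Import all_classical all_reals all_analysis.
From mathcomp Require Import complex ring zify.

Set Implicit Arguments.
Unset Strict Implicit.
Unset Printing Implicit Defensive.

Import Order.TTheory GRing.Theory Num.Theory.
Import numFieldNormedType.Exports.

Local Open Scope classical_set_scope.
Local Open Scope ring_scope.

Section Calculus.
Context {R : realType}.

(* Curves are total functions on [R] of which only the values on the open set
   [J] matter. A complex-valued curve is differentiated componentwise. *)
Definition C1_on (J : set R) (f : R -> R) : Prop :=
  forall t, J t -> derivable f t 1 /\ {for t, continuous (derive1 f)}.

Definition ReC (f : R -> R[i]) : R -> R := fun t => complex.Re (f t).
Definition ImC (f : R -> R[i]) : R -> R := fun t => complex.Im (f t).

Definition C1C_on (J : set R) (f : R -> R[i]) : Prop :=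
  C1_on J (ReC f) /\ C1_on J (ImC f).

Definition cderive (f : R -> R[i]) (t : R) : R[i] :=
  (derive1 (ReC f) t +i* derive1 (ImC f) t)%C.

Definition expi (x : R) : R[i] := (cos x +i* sin x)%C.

Definition C1_argument (J : set R) (f : R -> R[i]) (theta : R -> R) : Prop :=
  C1_on J theta /\ forall t, J t -> f t = expi (theta t).

End Calculus.

Section Laurent.
Context {R : realType}.
Local Notation C := R[i].
Implicit Types (n : nat) (f g a : int -> C) (G : C -> C).

(* The Laurent polynomial \sum_(-n <= j <= n) f_j z^j; the values of [f]
   outside [-n, n] play no role. *)
Definition laurent n f (z : C) : C :=
  \sum_(k < (2 * n).+1) f (k%:Z - n%:Z) * z ^ (k%:Z - n%:Z).

Definition laurent_coef_of n G f : Prop :=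
  forall z : C, `|z| = 1 -> G z = laurent n f z.

Definition in_Lambda n G : Prop := exists f, laurent_coef_of n G f.

Definition real_on_circle G : Prop :=
  forall z : C, `|z| = 1 -> G z \is Num.real.

(* Functions on the unit circle are identified with Laurent polynomials: the
   coefficients of a [G] with [in_Lambda n G] are unique (see
   [laurent_coef_uniq]), so that the choice is immaterial. *)
Definition laurent_coef n G : int -> C :=
  xget (fun=> 0) [set f | laurent_coef_of n G f].

(* The linear functional on Lambda_n with z^j |-> a_(-j). *)
Definition functional n a G : C :=
  \sum_(k < (2 * n).+1)
    laurent_coef n G (k%:Z - n%:Z) * a (- (k%:Z - n%:Z)).

Lemma horner_laurent n f z : z != 0 ->
  (\poly_(k < (2 * n).+1) f (k%:Z - n%:Z)).[z] = z ^+ n * laurent n f z.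
Proof.
move=> z0; rewrite horner_poly /laurent mulr_sumr; apply: eq_bigr => k _.
rewrite mulrCA; congr (_ * _).
by rewrite !exprnP -expfzDr // addrC subrK.
Qed.

Lemma laurent_coef_uniq n f g :
  (forall z : C, `|z| = 1 -> laurent n f z = laurent n g z) ->
  forall k : nat, (k <= 2 * n)%N -> f (k%:Z - n%:Z) = g (k%:Z - n%:Z).
Proof.
move=> fg k kn.
pose p h := \poly_(k < (2 * n).+1) (h (k%:Z - n%:Z) : C).
suff /(congr1 (fun q : {poly C} => q`_k)) : p f - p g = 0.
  by rewrite coefB !coef_poly ltnS kn coef0 => /eqP; rewrite subr_eq0 => /eqP.
pose d (l : nat) : C := 1 + 'i * l%:R.
pose w l : C := d l / (d l)^*.
have dC l : (d l)^* = 1 - 'i * l%:R by rewrite conjC_rect // realn.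
have d0 l : (d l)^* != 0.
  rewrite conjC_eq0; apply/eqP => /(congr1 (fun z : C => 'Re z)).
  by rewrite Re_rect ?realn // raddf0 => /eqP; rewrite oner_eq0.
have w1 l : `|w l| = 1.
  rewrite normrM normfV norm_conjC divff // normr_eq0.
  by rewrite -conjC_eq0 d0.
have winj : injective w.
  move=> l m; rewrite /w => /eqP; rewrite eqr_div // !dC => /eqP e.
  have /eqP : 'i * (l%:R - m%:R) *+ 2 = 0 :> C.
    apply/eqP; rewrite mulr2n mulrBr; move/eqP: e; rewrite -subr_eq0 /d.
    by congr (_ == 0); rewrite !(mulrDl, mulrDr, mulrBr, mulrBl, mul1r, mulr1) ; ring.
  rewrite mulrn_eq0 /= mulf_eq0 (negPf (neq0Ci _)) /= subr_eq0 eqr_nat => /eqP.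
  by [].
apply/eqP; apply/negPn/negP => q0.
pose s := [seq w l | l <- iota 0 (2 * n).+1].
have := max_poly_roots q0 (_ : all (root (p f - p g)) s) (_ : uniq s).
rewrite size_map size_iota => H.
suff : (size (p f - p g)%R <= (2 * n).+1)%N.
  rewrite leqNgt => /negP; apply; apply: H.
    apply/allP => _ /mapP [l _ ->].
    have wl0 : w l != 0 by rewrite -normr_eq0 w1 oner_eq0.
    by rewrite rootE hornerD hornerN !horner_laurent // (fg _ (w1 l)) subrr.
  by rewrite map_inj_uniq ?iota_uniq.
rewrite (leq_trans (size_polyD _ _)) // geq_max size_polyN.
by rewrite !size_poly.
Qed.

Lemma functional_laurent n a G f :
  laurent_coef_of n G f ->
  functional n a G =
  \sum_(k < (2 * n).+1) f (k%:Z - n%:Z) * a (- (k%:Z - n%:Z)).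
Proof.
move=> Gf; apply: eq_bigr => k _; congr (_ * _).
have Gl : laurent_coef_of n G (laurent_coef n G).
  exact: (@xgetPex _ (fun=> 0) [set h | laurent_coef_of n G h] (ex_intro _ f Gf)).
apply: (laurent_coef_uniq (n := n)) => [z z1|].
  by rewrite -Gl // Gf.
by rewrite -ltnS.
Qed.

End Laurent.

Section OrthogonalPolynomials.
Context {R : realType}.
Local Notation C := R[i].
Implicit Types (n m : nat) (a : int -> C) (w z : C).

Definition posdefmx m (A : 'M[C]_m) : Prop :=
  forall x : 'cV[C]_m, x != 0 -> 0 < ((map_mx Num.conj x)^T *m A *m x) 0 0.

Definition toeplitz a m : 'M[C]_m := \matrix_(r, s) a (r%:Z - s%:Z).

(* See [opuc_monic] and [opuc_orthogonal]. *)
Definition opuc a m : {poly C} :=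
  (\det (toeplitz a m))^-1 *:
  \det (\matrix_(r < m.+1, s < m.+1)
          (if (r < m)%N then (a (r%:Z - s%:Z))%:P else 'X^s)).

(* The coefficients of z^n * conj(p(1 / conj z)), for deg p <= n; see
   [horner_reversed]. *)
Definition reversed n (p : {poly C}) : {poly C} :=
  \poly_(k < n.+1) (p`_(n - k))^*.

(* L[|p|^2], for deg p <= n. *)
Definition sqnorm n a (p : {poly C}) : C :=
  functional n a (fun z => `|p.[z]| ^+ 2).

Definition opuc_norm n a m : {poly C} :=
  (sqrtC (sqnorm n a (opuc a m)))^-1 *: opuc a m.

(* This is K_(n-1). *)
Definition CDkernel n a (w z : C) : C :=
  \sum_(m < n) ((opuc_norm n a m).[w])^* * (opuc_norm n a m).[z].

Definition paraorth n a (b : C) : {poly C} :=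
  'X * opuc a n - b^* *: reversed n (opuc a n).

Definition hweight n a (b xi : C) : C :=
  sqnorm n a (paraorth n a b %/ ('X - xi%:P)).

Definition Vfun n a xi z : C :=
  2 * sqnorm n a (opuc a n) *
  'Im ((opuc a n).[z] * CDkernel n a z xi / (opuc a n).[xi]).

(* i (zeta - eta) z |P|^2 / ((z - zeta) (z - eta)), where |P|^2 = P * conj P
   and the zeros zeta, eta are divided out of the factor P. *)
Definition Bfun n a (b zeta eta : C) z : C :=
  'i * (zeta - eta) * z *
  (paraorth n a b %/ (('X - zeta%:P) * ('X - eta%:P))).[z] *
  ((paraorth n a b).[z])^*.

Lemma horner_reversed n (p : {poly C}) (z : C) : z != 0 -> (size p <= n.+1)%N ->
  (reversed n p).[z] = z ^+ n * (p.[1 / z^*])^*.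
Proof.
move=> z0 sp; rewrite horner_poly (horner_coef_wide _ sp) rmorph_sum mulr_sumr.
rewrite (reindex_inj rev_ord_inj); apply: eq_bigr => k _ /=.
rewrite subSS subKn -1?ltnS // rmorphM /= rmorphXn rmorphM /=.
rewrite fmorphV /= conjCK rmorph1 mul1r mulrCA; congr (_ * _).
rewrite exprVn; apply: (canRL (mulfK _)); first by rewrite expf_neq0.
by rewrite -exprD subnK // -ltnS.
Qed.
Let shift (p : {poly C}) (r : nat) : int -> C :=
  fun j => if j + r%:Z is Posz s then p`_s else 0.

Let shift_sum n (p : {poly C}) r (h : int -> C) :
  (r <= n)%N -> (size p <= n.+1)%N ->
  \sum_(k < (2 * n).+1) shift p r (k%:Z - n%:Z) * h (k%:Z - n%:Z) =
  \sum_(s < size p) p`_s * h (s%:Z - r%:Z).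
Proof.
move=> rn sp.
rewrite -(big_mkord xpredT (fun k : nat => shift p r (k%:Z - n%:Z) * h (k%:Z - n%:Z))).
rewrite (@big_cat_nat _ _ _ (n - r)) /=; [|lia|lia].
rewrite big_nat big1 ?add0r => [|k /andP[_ kn]]; last first.
  rewrite /shift; case E: (_ + _) => [s|s]; last by rewrite mul0r.
  by lia.
rewrite -{1}[(n - r)%N]add0n big_addn.
rewrite (@big_cat_nat _ _ _ (size p)) /=; [|done|apply: leq_trans sp _; lia].
rewrite [X in _ + X]big_nat [X in _ + X]big1 ?addr0 => [|k /andP[kp _]]; last first.
  rewrite /shift; have -> : (k + (n - r))%N%:Z - n%:Z + r%:Z = k by lia.
  by rewrite nth_default ?mul0r.
rewrite big_mkord; apply: eq_bigr => s _.
have -> : (s + (n - r))%N%:Z - n%:Z = s%:Z - r%:Z by lia.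
by rewrite /shift subrK.
Qed.

Lemma functional_conjX n a r (p : {poly C}) :
  (r <= n)%N -> (size p <= n.+1)%N ->
  functional n a (fun z => (z ^+ r)^* * p.[z]) =
  \sum_(s < size p) p`_s * a (r%:Z - s%:Z).
Proof.
move=> rn sp; rewrite (@functional_laurent _ _ _ _ (shift p r)); last first.
  move=> z z1; have z0 : z != 0 by rewrite -normr_eq0 z1 oner_eq0.
  rewrite /laurent (shift_sum (fun j => z ^ j)) // horner_coef mulr_sumr.
  apply: eq_bigr => s _; rewrite mulrCA; congr (_ * _).
  have zC : z^* = z^-1.
    by apply: (mulfI z0); rewrite -normCK z1 expr1n divff.
  by rewrite rmorphXn /= zC expfzDr // mulrC -!exprnP exprVn -exprnN.
rewrite (shift_sum (fun j => a (- j))) //.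
by apply: eq_bigr => s _; rewrite opprB.
Qed.

Lemma det_toeplitz_neq0 a n m :
  posdefmx (toeplitz a n) -> (m <= n)%N -> \det (toeplitz a m) != 0.
Proof.
move=> pd mn; apply/det0P => -[v v0 /matrixP vA].
pose x : 'cV[C]_n := \col_i (if insub (val i) is Some j then (v 0 j)^* else 0).
have xE (j : 'I_m) : x (widen_ord mn j) 0 = (v 0 j)^*.
  by rewrite mxE /= valK.
have x0 : x != 0.
  apply: contra v0 => /eqP xx; apply/eqP/rowP => j; rewrite !mxE.
  by apply/eqP; rewrite -conjC_eq0 -xE xx mxE.
have := pd x x0; rewrite mxE.
suff -> : \sum_j ((map_mx Num.conj x)^T *m toeplitz a n) 0 j * x j 0 = 0 by rewrite ltxx.
apply: big1 => j _.
have [jm|jm] := ltnP j m; last first.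
  by rewrite [x j 0]mxE insubN ?mulr0 // -leqNgt.
have := vA 0 (Ordinal jm); rewrite !mxE => vj.
suff -> : \sum_i (map_mx Num.conj x)^T 0 i * toeplitz a n i j = 0 by rewrite mul0r.
rewrite -[RHS]vj (bigID (fun i : 'I_n => (i < m)%N)) /= addrC big1 ?add0r.
  rewrite (big_ord_narrow mn); apply: eq_bigr => i _.
  by rewrite 2!mxE xE conjCK !mxE.
by move=> i im; rewrite !mxE insubN ?rmorph0 ?mul0r.
Qed.

Let bordered a m (v : nat -> C) : 'M[C]_m.+1 :=
  \matrix_(r, s) (if (r < m)%N then a (r%:Z - s%:Z) else v s).

Let cof a m s := cofactor (bordered a m (fun=> 0)) ord_max s.

Let det_bordered a m v :
  \det (bordered a m v) = \sum_s v (val s) * @cof a m s.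
Proof.
rewrite (expand_det_row _ ord_max); apply: eq_bigr => s _.
rewrite mxE /= ltnn; congr (_ * _); rewrite /cof /cofactor; congr (_ * \det _).
apply/matrixP => i j; rewrite !mxE lift_max /=.
by rewrite ltn_ord.
Qed.

Let opucE a m :
  opuc a m = (\det (toeplitz a m))^-1 *: \poly_(s < m.+1) @cof a m (inord s).
Proof.
rewrite /opuc; congr (_ *: _); rewrite (expand_det_row _ ord_max) poly_def.
apply: eq_bigr => s _; rewrite inord_val mxE /= ltnn -mul_polyC mulrC.
congr (_ * _); rewrite /cof -cofactor_map_mx /cofactor; congr (_ * \det _).
by apply/matrixP => i j; rewrite !mxE lift_max /= ltn_ord.
Qed.

Let cof_max a m : @cof a m ord_max = \det (toeplitz a m).
Proof.
rewrite /cof /cofactor addnn -signr_odd odd_double expr0 mul1r; congr (\det _).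
by apply/matrixP => i j; rewrite !mxE !lift_max /= ltn_ord.
Qed.

Lemma opuc_monic a n m :
  posdefmx (toeplitz a n.+1) -> (m <= n)%N ->
  opuc a m \is monic /\ size (opuc a m) = m.+1.
Proof.
move=> pd mn; have d0 := det_toeplitz_neq0 pd (leqW mn).
have mM : inord m = ord_max :> 'I_m.+1 by apply/val_inj; rewrite /= inordK.
have sE : size (opuc a m) = m.+1.
  by rewrite opucE size_scale ?invr_eq0 // size_poly_eq // mM cof_max.
split=> //; rewrite monicE lead_coefE sE /= opucE coefZ coef_poly ltnSn mM.
by rewrite cof_max mulVf.
Qed.

Lemma opuc_orthogonal a n m r :
  posdefmx (toeplitz a n.+1) -> (m <= n)%N -> (r < m)%N ->
  functional n a (fun z => (z ^+ r)^* * (opuc a m).[z]) = 0.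
Proof.
move=> pd mn rm; have [_ sE] := opuc_monic pd mn.
rewrite functional_conjX ?sE ?ltnS //; last exact: leq_trans (ltnW rm) mn.
have := det_bordered a m (fun s => a (r%:Z - s%:Z)).
rewrite (determinant_alternate (i1 := inord r) (i2 := ord_max)); last 2 first.
- by rewrite -val_eqE /= inordK ?ltn_eqF // ltnS ltnW.
- by move=> s; rewrite !mxE inordK ?ltnS ?(ltnW rm) // rm ltnn.
move=> H; apply: (@mulfI _ (\det (toeplitz a m))).
  exact: det_toeplitz_neq0 pd (leqW mn).
rewrite mulr0 [RHS]H mulr_sumr; apply: eq_bigr => s _.
rewrite opucE coefZ coef_poly ltn_ord inord_val.
by rewrite -mulrA mulVKf ?(det_toeplitz_neq0 pd (leqW mn)) // mulrC.
Qed.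
End OrthogonalPolynomials.

Section Flow.
Context {R : realType}.
Local Notation C := R[i].
Implicit Types (n : nat) (c : nat -> R -> C) (t : R).

(* [c] lists the moments of index j >= 0, and c_(-j) is conj(c_j). *)
Definition moment c (j : int) t : C :=
  match j with Posz k => c k t | Negz k => (c k.+1 t)^* end.

Definition moments c t : int -> C := fun j => moment c j t.

Definition Ldot n c t : (C -> C) -> C :=
  functional n (fun j => cderive (moment c j) t).

Definition zero_branch n c (b : R -> C) (J : set R) (xi : R -> C) : Prop :=
  C1C_on J xi /\
  forall t, J t ->
    `|xi t| = 1 /\ root (paraorth n (moments c t) (b t)) (xi t).

End Flow.

(* Main.v *)
Require Import Defs.
From mathcomp Require Import all_boot all_order all_algebra.
From mathcomp Require Import all_classical all_reals all_analysis.
From mathcomp Require Import complex.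
From mathcomp Require Import ring zify.

Set Implicit Arguments.
Unset Strict Implicit.
Unset Printing Implicit Defensive.

Import Order.TTheory GRing.Theory Num.Theory.
Import numFieldNormedType.Exports.

Local Open Scope classical_set_scope.
Local Open Scope ring_scope.

(** Every zero xi of P satisfies P = (z - xi) g with g of degree n, and the
    orthogonality of P to z, ..., z^n (para-orthogonality) turns into
    [ip_quotient]: g is orthogonal to (1 - conj(xi) z) h for all h of degree
    below n, that is, to every polynomial of degree at most n that vanishes at
    1 / conj(xi). Hence g does not vanish there, for otherwise it would be
    orthogonal to itself. As the zeros of P are symmetric in the unit circle,
    this one fact shows that they all lie on the circle and are simple. It also
    makes g a multiple of the reproducing kernel at xi: <f, g> is
    conj(f(xi)) <1, g> ([ip_eval]), from which
    h_xi Q_n(xi) = nu g(xi) ([hweight_opuc]).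

    The flow of the zeros is then implicit differentiation,
    g(xi) xi' = - P_t(xi), where P_t is the derivative of P in t at a fixed
    point; the remaining work is to compute P_t(xi) by differentiating
    orthogonality relations in which the other polynomial is held fixed.
    With k the reproducing kernel of degree below n at xi, the relation
    <k, Q_n> = 0 differentiates to Ldot[conj(k) Q_n] = - q(xi), q the
    t-derivative of Q_n, which gives the formula with V_xi ([branch_formula]).
    With P = (z - zeta)(z - eta) G, the relation L[conj(P) z G] = 0
    differentiates to Ldot[conj(P) z G] = - L[conj(P_t) z G]; since
    (zeta - eta) z G is zeta g_zeta - eta g_eta, [ip_eval] evaluates the
    right-hand side at zeta and at eta, which gives the formula with B
    ([two_branches_formula]).

    For the existence of the branches, an estimate of the product over the
    roots and a pigeonhole argument show that near a given time the zeros of P,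
    being simple, form n + 1 disjoint continuous branches. Over an interval,
    local sections that are locally unique glue to a global one
    ([glue_sections]); the same lemma lifts a curve on the circle to a
    continuous argument. Divided differences and the arcsine then upgrade
    continuity to the class C^1. *)

(** * Laurent polynomials on the circle *)

Section LaurentFunctional.
Context {R : realType}.
Local Notation C := R[i].
Implicit Types (n : nat) (a f : int -> C) (G H : C -> C).

(** Exponents may repeat in the sum, so that a double sum over the coefficients
    of two polynomials can be fed in directly. *)
Lemma laurent_of_sum n (I : finType) (x : I -> C) (e : I -> int) G :
  (forall i, x i != 0 -> (`|e i| <= n)%N) ->
  (forall z, `|z| = 1 -> G z = \sum_i x i * z ^ e i) ->
  in_Lambda n G /\ forall a, functional n a G = \sum_i x i * a (- e i).
Proof.
move=> xe GE; pose F j := \sum_(i | e i == j) x i.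
have sumF (h : int -> C) :
    \sum_(k < (2 * n).+1) F (k%:Z - n%:Z) * h (k%:Z - n%:Z) = \sum_i x i * h (e i).
  under eq_bigr => k _ do rewrite /F big_mkcond mulr_suml.
  rewrite exchange_big; apply: eq_bigr => i _.
  have [->|xi] := eqVneq (x i) 0.
    by rewrite mul0r big1 // => k _; rewrite if_same mul0r.
  have ein := xe i xi; have kP : (absz (e i + n%:Z)%R < (2 * n).+1)%N by lia.
  have kE : (absz (e i + n%:Z)%R)%:Z - n%:Z = e i by lia.
  rewrite (bigD1 (Ordinal kP)) //= kE eqxx big1 ?addr0 // => k kn.
  case: eqP => [eE|_]; last by rewrite ?mul0r.
  by case/negP: kn; apply/eqP/val_inj => /=; rewrite eE; lia.
have GF : laurent_coef_of n G F by move=> z z1; rewrite GE // /laurent sumF.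
split=> [|a]; first by exists F.
by rewrite (functional_laurent _ GF) (sumF (fun j => a (- j))).
Qed.

Lemma functional_eq n a G H : (forall z, `|z| = 1 -> G z = H z) ->
  functional n a G = functional n a H.
Proof.
move=> GH; rewrite /functional /laurent_coef.
suff -> : [set f | laurent_coef_of n G f] = [set f | laurent_coef_of n H f] by [].
by apply/seteqP; split=> f fG z z1; [rewrite -GH|rewrite GH] => //; exact: fG.
Qed.

Lemma in_Lambda_eq n G H : (forall z, `|z| = 1 -> G z = H z) ->
  in_Lambda n G -> in_Lambda n H.
Proof. by move=> GH [f fG]; exists f => z z1; rewrite -GH // fG. Qed.

Lemma functional_lin n G H (u v : C) : in_Lambda n G -> in_Lambda n H ->
  in_Lambda n (fun z => u * G z + v * H z) /\
  forall a, functional n a (fun z => u * G z + v * H z) =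
    u * functional n a G + v * functional n a H.
Proof.
move=> [f Gf] [h Hh]; pose F j := u * f j + v * h j.
have FE : laurent_coef_of n (fun z => u * G z + v * H z) F.
  move=> z z1; rewrite /= Gf // Hh // /laurent !mulr_sumr -big_split /=.
  by apply: eq_bigr => k _; rewrite /F mulrDl !mulrA.
split=> [|a]; first by exists F.
rewrite (functional_laurent _ FE) (functional_laurent _ Gf) (functional_laurent _ Hh).
rewrite !mulr_sumr -big_split /=.
by apply: eq_bigr => k _; rewrite /F mulrDl !mulrA.
Qed.

Lemma conjC_circle (z : C) : `|z| = 1 -> z^* = z^-1.
Proof.
move=> z1; have z0 : z != 0 by rewrite -normr_eq0 z1 oner_eq0.
by apply: (mulfI z0); rewrite -normCK z1 expr1n divff.
Qed.

Lemma conj_exprz (z : C) (j : int) : `|z| = 1 -> (z ^ j)^* = z ^ (- j).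
Proof.
move=> z1; case: (intP j) => [|k|k]; first by rewrite oppr0 expr0z rmorph1.
  by rewrite -exprnP rmorphXn /= conjC_circle // exprVn exprnN.
by rewrite -exprnN opprK -exprnP -exprVn -(conjC_circle z1) rmorphXn /= conjCK.
Qed.

Lemma laurent_rev n f (g : int -> C) :
  \sum_(k < (2 * n).+1) f (k%:Z - n%:Z) * g (k%:Z - n%:Z) =
  \sum_(k < (2 * n).+1) f (- (k%:Z - n%:Z)) * g (- (k%:Z - n%:Z)).
Proof.
rewrite (reindex_inj rev_ord_inj); apply: eq_bigr => k _ /=.
have kn := ltn_ord k.
by have -> : ((2 * n).+1 - k.+1)%N%:Z - n%:Z = - (k%:Z - n%:Z) by lia.
Qed.

Lemma laurent_conj n f z : `|z| = 1 ->
  (laurent n f z)^* = laurent n (fun j => (f (- j))^*) z.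
Proof.
move=> z1; rewrite /laurent laurent_rev rmorph_sum; apply: eq_bigr => k _.
rewrite rmorphM /=; congr (_ * _).
by rewrite conj_exprz // opprK.
Qed.

Definition herm n a := forall j, (`|j| <= n)%N -> a (- j) = (a j)^*.

(** Conjugation on the circle reverses the coefficients, which Hermitian moments
    undo. *)
Lemma functional_conj n G : in_Lambda n G ->
  in_Lambda n (fun z => (G z)^*) /\
  forall a, herm n a -> functional n a (fun z => (G z)^*) = (functional n a G)^*.
Proof.
move=> [f Gf]; pose F j := (f (- j))^*.
have FE : laurent_coef_of n (fun z => (G z)^*) F.
  by move=> z z1; rewrite /= Gf // laurent_conj.
split=> [|a ha]; first by exists F.
rewrite (functional_laurent _ FE) (functional_laurent _ Gf).
rewrite (laurent_rev n f (fun j => a (- j))) rmorph_sum; apply: eq_bigr => k _.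
have kn := ltn_ord k.
by rewrite rmorphM /F opprK ha //; lia.
Qed.

End LaurentFunctional.

(** * The sesquilinear form of a moment sequence *)

Section InnerProduct.
Context {R : realType}.
Local Notation C := R[i].
Variables (n : nat) (a : int -> C).
Implicit Types (f g h : {poly C}) (u : C).

(** Only the moments of index at most n in absolute value are data. Replacing
    the others by 0 keeps [ip] independent of them, and keeps it differentiable
    along a flow that controls only the data. *)
Definition trunc (j : int) : C := if (`|j| <= n)%N then a j else 0.

(** The value of L[conj(f) g]. The range admits degree n + 1, because P has that
    degree; the value is meaningful as soon as no product of coefficients meets
    a truncated moment, see [functional_ip]. *)
Definition ip f g : C :=
  \sum_(r < n.+2) \sum_(s < n.+2) (f`_r)^* * g`_s * trunc (r%:Z - s%:Z).

Lemma ip_linr f u g h : ip f (u *: g + h) = u * ip f g + ip f h.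
Proof.
rewrite /ip mulr_sumr -big_split; apply: eq_bigr => r _ /=.
rewrite mulr_sumr -big_split; apply: eq_bigr => s _ /=.
by rewrite coefD coefZ mulrDr mulrDl !mulrA [_ * u]mulrC.
Qed.

Lemma ip_linl f u g h : ip (u *: g + h) f = u^* * ip g f + ip h f.
Proof.
rewrite /ip mulr_sumr -big_split; apply: eq_bigr => r _ /=.
rewrite mulr_sumr -big_split; apply: eq_bigr => s _ /=.
by rewrite coefD coefZ rmorphD rmorphM /= !mulrDl !mulrA.
Qed.

Lemma ip0r f : ip f 0 = 0.
Proof.
by rewrite /ip big1 // => r _; rewrite big1 // => s _; rewrite coef0 mulr0 mul0r.
Qed.

Lemma ip0l f : ip 0 f = 0.
Proof.
by rewrite /ip big1 // => r _; rewrite big1 // => s _; rewrite coef0 rmorph0 !mul0r.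
Qed.

Lemma ipDr f g h : ip f (g + h) = ip f g + ip f h.
Proof. by rewrite -[g]scale1r ip_linr mul1r scale1r. Qed.

Lemma ipDl f g h : ip (g + h) f = ip g f + ip h f.
Proof. by rewrite -[g]scale1r ip_linl rmorph1 mul1r scale1r. Qed.

Lemma ipZr f u g : ip f (u *: g) = u * ip f g.
Proof. by rewrite -[_ *: g]addr0 ip_linr ip0r addr0. Qed.

Lemma ipZl f u g : ip (u *: g) f = u^* * ip g f.
Proof. by rewrite -[_ *: g]addr0 ip_linl ip0l addr0. Qed.

Lemma ipBr f g h : ip f (g - h) = ip f g - ip f h.
Proof. by rewrite -scaleN1r ipDr ipZr mulN1r. Qed.

Lemma ipBl f g h : ip (g - h) f = ip g f - ip h f.
Proof. by rewrite -scaleN1r ipDl ipZl rmorphN1 mulN1r. Qed.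

Lemma functional_ip f g : (size f <= n.+2)%N -> (size g <= n.+2)%N ->
  (forall r s : nat, f`_r != 0 -> g`_s != 0 -> (r <= s + n)%N && (s <= r + n)%N) ->
  in_Lambda n (fun z => (f.[z])^* * g.[z]) /\
  functional n a (fun z => (f.[z])^* * g.[z]) = ip f g.
Proof.
move=> sf sg fgn.
pose x (p : 'I_n.+2 * 'I_n.+2) := (f`_p.1)^* * g`_p.2.
pose e (p : 'I_n.+2 * 'I_n.+2) : int := (p.2 : nat)%:Z - (p.1 : nat)%:Z.
have xe p : x p != 0 -> (`|e p| <= n)%N.
  rewrite /x mulf_eq0 conjC_eq0 negb_or => /andP[f0 g0].
  by have := fgn _ _ f0 g0; rewrite /e; lia.
have [|inL fE] := laurent_of_sum (G := fun z => (f.[z])^* * g.[z]) xe; last first.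
  split=> //; rewrite fE /ip pair_big; apply: eq_bigr => p _.
  rewrite opprB /trunc; case: ifP => // en.
  have [x0|/xe] := eqVneq (x p) 0; first by rewrite mulr0 x0 mul0r.
  by rewrite /e distnC en.
move=> z z1; rewrite (horner_coef_wide _ sf) (horner_coef_wide _ sg).
have z0 : z != 0 by rewrite -normr_eq0 z1 oner_eq0.
rewrite rmorph_sum big_distrlr pair_big /=; apply: eq_bigr => p _.
rewrite /x /e rmorphM /= expfzDr // mulrACA; congr (_ * _).
by rewrite -conj_exprz // mulrC.
Qed.

Lemma functional_ip_small f g : (size f <= n.+1)%N -> (size g <= n.+1)%N ->
  in_Lambda n (fun z => (f.[z])^* * g.[z]) /\
  functional n a (fun z => (f.[z])^* * g.[z]) = ip f g.
Proof.
move=> sf sg; apply: functional_ip; try exact: leqW.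
have coef_lt (h : {poly C}) k : (size h <= n.+1)%N -> h`_k != 0 -> (k <= n)%N.
  move=> sh; apply: contraNT; rewrite -ltnNge => nk.
  by rewrite nth_default ?(leq_trans sh).
by move=> r s /(coef_lt _ _ sf) rn /(coef_lt _ _ sg) sn; apply/andP; split; lia.
Qed.

Lemma sqnorm_ip f : (size f <= n.+1)%N -> sqnorm n a f = ip f f.
Proof.
move=> sf; rewrite -(functional_ip_small sf sf).2.
by apply: functional_eq => z _; rewrite normCK mulrC.
Qed.

(** The form is Toeplitz: multiplication by z is an isometry. *)
Lemma ip_shift f g : (size f <= n.+1)%N -> (size g <= n.+1)%N ->
  ip ('X * f) ('X * g) = ip f g.
Proof.
move=> sf sg; rewrite {1}/ip big_ord_recl big1 ?add0r; last first.
  by move=> s _; rewrite coefXM eqxx rmorph0 !mul0r.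
rewrite [RHS]/ip [RHS]big_ord_recr /= [X in _ = _ + X]big1 ?addr0; last first.
  by move=> s _; rewrite (nth_default _ sf) rmorph0 !mul0r.
apply: eq_bigr => r _; rewrite big_ord_recl !coefXM mulr0 mul0r add0r.
rewrite [RHS]big_ord_recr /= (nth_default _ sg) mulr0 mul0r addr0.
apply: eq_bigr => s _; rewrite !coefXM /= /bump /= !add1n; congr (_ * trunc _).
by lia.
Qed.

Lemma ipXl k g : (k <= n.+1)%N ->
  ip 'X^k g = \sum_(s < n.+2) g`_s * trunc (k%:Z - s%:Z).
Proof.
move=> kn; rewrite /ip (bigD1 (Ordinal (kn : (k < n.+2)%N))) //= [X in _ + X]big1 ?addr0.
  by apply: eq_bigr => s _; rewrite coefXn eqxx rmorph1 mul1r.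
move=> r rk; rewrite big1 // => s _; rewrite coefXn; case: eqP => [rk'|_].
  by case/negP: rk; apply/eqP/val_inj.
by rewrite rmorph0 !mul0r.
Qed.

Lemma ip_coefl f g : ip f g = \sum_(r < n.+2) (f`_r)^* * ip 'X^r g.
Proof.
rewrite {1}/ip; apply: eq_bigr => r _; rewrite ipXl ?mulr_sumr; last by rewrite -ltnS.
by apply: eq_bigr => s _; rewrite mulrA.
Qed.

Hypothesis a_herm : herm n a.

Lemma trunc_herm j : trunc (- j) = (trunc j)^*.
Proof.
rewrite /trunc; have -> : `|- j|%N = `|j|%N by lia.
by case: ifP => [/a_herm//|_]; rewrite rmorph0.
Qed.

Lemma ip_conj f g : (ip f g)^* = ip g f.
Proof.
rewrite /ip exchange_big rmorph_sum; apply: eq_bigr => r _ /=.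
rewrite rmorph_sum; apply: eq_bigr => s _.
by rewrite !rmorphM /= conjCK -trunc_herm opprB; congr (_ * _); rewrite mulrC.
Qed.

Hypothesis a_pd : posdefmx (toeplitz a n.+1).

Lemma ip_gt0 f : (size f <= n.+1)%N -> f != 0 -> 0 < ip f f.
Proof.
move=> sf f0; pose x : 'cV[C]_n.+1 := \col_i f`_i.
have x0 : x != 0.
  apply: contra f0 => /eqP/matrixP x0; apply/eqP/polyP => i; rewrite coef0.
  have [ni|/ltnSE iN] := leqP n.+1 i; first by rewrite nth_default ?(leq_trans sf).
  by have := x0 (Ordinal (iN : (i < n.+1)%N)) 0; rewrite !mxE.
suff -> : ip f f = ((map_mx Num.conj x)^T *m toeplitz a n.+1 *m x) 0 0.
  exact: a_pd.
rewrite mxE; under eq_bigr => j _ do rewrite mxE mulr_suml.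
rewrite exchange_big /ip [LHS]big_ord_recr /= [X in _ + X = _]big1 ?addr0; last first.
  by move=> s _; rewrite (nth_default _ sf) rmorph0 !mul0r.
apply: eq_bigr => r _.
rewrite big_ord_recr /= (nth_default _ sf) mulr0 mul0r addr0.
apply: eq_bigr => s _; rewrite !mxE /trunc.
have rn := ltn_ord r; have sn := ltn_ord s.
have -> : (`|r%:Z - s%:Z| <= n)%N by lia.
by rewrite mulrAC.
Qed.

End InnerProduct.

(** * Zeros of para-orthogonal polynomials *)

Section Paraorthogonal.
Context {R : realType}.
Local Notation C := R[i].
Variables (n : nat) (a : int -> C).
Hypothesis a_herm : herm n a.
Hypothesis a_pd : posdefmx (toeplitz a n.+1).
Implicit Types (f g h : {poly C}) (b z xi : C).

Local Notation "<< f , g >>" := (ip n a f g).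
Local Notation Q := (opuc a n).

Lemma size_opuc m : (m <= n)%N -> size (opuc a m) = m.+1.
Proof. by move=> mn; have [] := opuc_monic a_pd mn. Qed.

Lemma monic_opuc m : (m <= n)%N -> opuc a m \is monic.
Proof. by move=> mn; have [] := opuc_monic a_pd mn. Qed.

Lemma ip_opuc m f : (m <= n)%N -> (size f <= m)%N -> <<f, opuc a m>> = 0.
Proof.
move=> mn fm; rewrite ip_coefl big1 // => r _.
have [rm|mr] := ltnP r m; last first.
  by rewrite (nth_default _ (leq_trans fm mr)) rmorph0 mul0r.
rewrite -(functional_ip_small a _ _).2 ?size_polyXn ?size_opuc //; last first.
  by rewrite ltnS (leq_trans (ltnW rm)).
suff -> : functional n a (fun z => ('X^r).[z]^* * (opuc a m).[z]) = 0.
  by rewrite mulr0.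
rewrite -(opuc_orthogonal a_pd mn rm); apply: functional_eq => z _.
by rewrite hornerXn.
Qed.

(** With Hermitian moments, <z^k, Q_n^*> is the conjugate of <z^(n - k), Q_n>,
    and Q_n is orthogonal to z^(n - k) since k > 0. *)
Lemma ip_Xrev k : (0 < k <= n)%N -> <<'X^k, reversed n Q>> = 0.
Proof.
move=> /andP[k0 kn]; have nk : (n - k < n)%N by lia.
have /(congr1 Num.conj) : <<'X^(n - k), Q>> = 0.
  by rewrite ip_opuc // size_polyXn.
rewrite rmorph0 => e; rewrite -[RHS]e !ipXl; [|lia..].
rewrite [LHS]big_ord_recr [X in _ = X^*]big_ord_recr /=.
rewrite [Q`_n.+1]nth_default ?size_opuc // coef_poly ltnn !mul0r !addr0.
rewrite (reindex_inj rev_ord_inj) rmorph_sum; apply: eq_bigr => s _ /=.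
have sn := ltn_ord s.
rewrite coef_poly ifT; last by lia.
rewrite rmorphM /= -(trunc_herm a_herm).
have -> : (n - (n.+1 - s.+1))%N = s by lia.
by congr (_ * trunc _ _ _); lia.
Qed.

Lemma ip_rev h : (size h <= n)%N -> <<'X * h, reversed n Q>> = 0.
Proof.
move=> hn; rewrite ip_coefl big1 // => -[[|r] /= rn] _.
  by rewrite coefXM eqxx rmorph0 mul0r.
rewrite coefXM /=; have [nr|rn'] := leqP n r.
  by rewrite (nth_default _ (leq_trans hn nr)) rmorph0 mul0r.
by rewrite ip_Xrev ?mulr0.
Qed.

Lemma ip_opuc_monic g : size g = n.+1 -> g \is monic -> <<g, Q>> = <<Q, Q>>.
Proof.
move=> sg mg; rewrite -[g](subrK Q) ipDl ip_opuc ?add0r //.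
have := monic_opuc (leqnn n); rewrite monicE lead_coefE size_opuc //= => /eqP Qn.
move: mg; rewrite monicE lead_coefE sg /= => /eqP gn.
apply/leq_sizeP => j; rewrite leq_eqVlt coefB => /predU1P[<-|nj].
  by rewrite gn Qn subrr.
by rewrite !nth_default ?subrr ?sg ?size_opuc.
Qed.

Lemma ip_opuc_gt0 m : (m <= n)%N -> 0 < <<opuc a m, opuc a m>>.
Proof.
move=> mn; apply: ip_gt0 => //; first by rewrite size_opuc.
exact: monic_neq0 (monic_opuc mn).
Qed.

Lemma size_reversed f : (size (reversed n f) <= n.+1)%N.
Proof. exact: size_poly. Qed.

Lemma size_paraorth b : size (paraorth n a b) = n.+2.
Proof.
have Q0 := monic_neq0 (monic_opuc (leqnn n)).
rewrite /paraorth mulrC size_polyDl ?size_mulX ?size_opuc // size_polyN ltnS.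
exact: leq_trans (size_scale_leq _ _) (size_reversed _).
Qed.

Lemma monic_paraorth b : paraorth n a b \is monic.
Proof.
have Q0 := monic_neq0 (monic_opuc (leqnn n)).
rewrite monicE /paraorth lead_coefDl ?lead_coefM ?lead_coefX ?mul1r.
  by rewrite -monicE monic_opuc.
rewrite mulrC size_mulX // size_opuc // size_polyN ltnS.
exact: leq_trans (size_scale_leq _ _) (size_reversed _).
Qed.

Lemma horner_paraorth b z :
  (paraorth n a b).[z] = z * Q.[z] - b^* * (reversed n Q).[z].
Proof. by rewrite hornerD hornerN hornerM hornerX (hornerZ b^*). Qed.

Lemma paraorth_at0 b : (paraorth n a b).[0] = - b^*.
Proof.
rewrite horner_paraorth mul0r add0r.
rewrite horner_coef0 coef_poly subn0.
have := monic_opuc (leqnn n); rewrite monicE lead_coefE size_opuc //= => /eqP->.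
by rewrite rmorph1 mulr1.
Qed.

(** Para-orthogonality: z Q_n is orthogonal to z h because Q_n is orthogonal to
    h, and Q_n^* is by [ip_rev]. *)
Lemma ip_paraorth b h : (size h <= n)%N -> <<'X * h, paraorth n a b>> = 0.
Proof.
move=> hn; rewrite /paraorth ipBr ipZr ip_rev // mulr0 subr0.
by rewrite ip_shift ?size_opuc ?ip_opuc // leqW.
Qed.

(** P agrees with its reversed polynomial up to a unimodular factor. *)
Lemma paraorth_reflect b z : `|b| = 1 -> z != 0 ->
  root (paraorth n a b) z -> root (paraorth n a b) (1 / z^*).
Proof.
move=> b1 z0; rewrite !rootE !horner_paraorth.
set w := 1 / z^*; have zc0 : z^* != 0 by rewrite conjC_eq0.
have w0 : w != 0 by rewrite /w mul1r invr_eq0.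
have zw : 1 / w^* = z by rewrite /w !mul1r fmorphV /= invrK conjCK.
have sQ : (size Q <= n.+1)%N by rewrite size_opuc.
rewrite !horner_reversed // zw -/w.
have bb : b * b^* = 1 by rewrite -normCK b1 expr1n.
rewrite !subr_eq0 => /eqP /(congr1 Num.conj).
rewrite !rmorphM rmorphXn /= !conjCK.
have -> : z^* = w^-1 by rewrite /w mul1r invrK.
move=> e; apply/eqP.
have -> : (Q.[z])^* = w * (w^-1 * (Q.[z])^*) by rewrite mulVKf.
rewrite e exprVn.
have -> : b^* * (w ^+ n * (w * (b * (w ^- n * Q.[w])))) =
  (b * b^*) * (w ^+ n * w ^- n) * (w * Q.[w]) by rewrite -[w ^- n]/((w ^+n)^-1); ring.
by rewrite bb divff ?expf_neq0 // !mul1r.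
Qed.

Section Root.
Variables (b xi : C).
Hypothesis b1 : `|b| = 1.
Local Notation P := (paraorth n a b).
Hypothesis Pxi : root P xi.
Local Notation g := (P %/ ('X - xi%:P)).

Lemma quotient_mul : P = ('X - xi%:P) * g.
Proof. by rewrite mulrC divpK // dvdp_XsubCl. Qed.

Lemma size_quotient : size g = n.+1.
Proof. by rewrite size_divp ?polyXsubC_eq0 // size_XsubC subn1 size_paraorth. Qed.

Lemma monic_quotient : g \is monic.
Proof. by have := monic_paraorth b; rewrite {1}quotient_mul monicMl ?monicXsubC. Qed.

Lemma quotient_neq0 : g != 0.
Proof. exact: monic_neq0 monic_quotient. Qed.

(** Expand 0 = <z h, P> with P = z g - xi g, and remove the common factor z from
    <z h, z g>. *)
Lemma ip_quotient h : (size h <= n)%N -> <<h - xi^* *: ('X * h), g>> = 0.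
Proof.
move=> hn; rewrite -[RHS](ip_paraorth b hn) [in RHS]quotient_mul mulrBl mul_polyC.
rewrite ipBr ipZr ip_shift ?size_quotient //; last exact: leqW.
by rewrite ipBl ipZl conjCK.
Qed.

Lemma paraorth_root_neq0 : xi != 0.
Proof.
apply: contraL Pxi => /eqP ->; rewrite rootE paraorth_at0 oppr_eq0 conjC_eq0.
by rewrite -normr_eq0 b1 oner_eq0.
Qed.

(** If g vanished at 1 / conj(xi), it would be a multiple of some
    h - conj(xi) z h, hence orthogonal to itself by [ip_quotient]. *)
Lemma quotient_reflect_neq0 : g.[1 / xi^*] != 0.
Proof.
apply/negP => g0; have xc0 : xi^* != 0 by rewrite conjC_eq0 paraorth_root_neq0.
pose h := g %/ ('X - (1 / xi^*)%:P).
have gE : g = (- (xi^*)^-1) *: (h - xi^* *: ('X * h)).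
  rewrite -[LHS](divpK (d := 'X - (1 / xi^*)%:P)) ?dvdp_XsubCl //.
  rewrite -/h scalerBr scalerA mulNr mulVf // scaleN1r opprK mulrBr mul1r addrC.
  by rewrite [h * _%:P]mulrC mul_polyC scaleNr [h * 'X]mulrC.
have hn : (size h <= n)%N.
  by rewrite size_divp ?polyXsubC_eq0 // size_XsubC subn1 size_quotient.
have := ip_gt0 a_pd (eq_leq size_quotient) quotient_neq0.
by rewrite {1}gE ipZl ip_quotient // mulr0 ltxx.
Qed.

(** Otherwise 1 / conj(xi) would be a zero of P other than xi, hence a zero
    of g. *)
Lemma paraorth_root_circle : `|xi| = 1.
Proof.
have xc0 : xi^* != 0 by rewrite conjC_eq0 paraorth_root_neq0.
have := paraorth_reflect b1 paraorth_root_neq0 Pxi.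
rewrite [X in root X _]quotient_mul rootM root_XsubC => /orP[/eqP e|]; last first.
  by rewrite rootE (negPf quotient_reflect_neq0).
apply/eqP; rewrite -sqrp_eq1 // normCK -[X in X * _]e.
by rewrite mul1r mulVf.
Qed.

(** The zero is simple: on the circle 1 / conj(xi) is xi itself. *)
Lemma quotient_at_root_neq0 : g.[xi] != 0.
Proof.
have := quotient_reflect_neq0.
by rewrite (conjC_circle paraorth_root_circle) mul1r invrK.
Qed.

(** The polynomial f - f(xi) vanishes at xi = 1 / conj(xi), so that it has the
    form to which [ip_quotient] applies. *)
Lemma ip_eval f : (size f <= n.+1)%N -> <<f, g>> = (f.[xi])^* * <<1, g>>.
Proof.
move=> fn; have x1 := paraorth_root_circle.
have x0 : xi^* != 0 by rewrite conjC_eq0 paraorth_root_neq0.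
rewrite -[(_ ^*) * _]ipZl; apply/eqP; rewrite -subr_eq0 -ipBl; apply/eqP.
set u := f - _; have /factor_theorem [h uE] : root u xi.
  by rewrite rootE !hornerE subrr.
have su : (size u <= n.+1)%N.
  rewrite (leq_trans (size_polyD _ _)) // geq_max fn size_polyN.
  by rewrite (leq_trans (size_scale_leq _ _)) // size_poly1.
have hn : (size h <= n)%N.
  have [->|h0] := eqVneq h 0; first by rewrite size_poly0.
  by move: su; rewrite uE size_mul ?polyXsubC_eq0 // size_XsubC addn2.
have -> : u = (- xi) *: (h - xi^* *: ('X * h)).
  rewrite uE scalerBr scalerA mulNr -normCK x1 expr1n scaleN1r opprK.
  by rewrite mulrBr [h * _%:P]mulrC mul_polyC scaleNr addrC [h * 'X]mulrC.
by rewrite ipZl ip_quotient // mulr0.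
Qed.

End Root.
End Paraorthogonal.


(** * Weights and the reproducing kernel *)

Section Kernel.
Context {R : realType}.
Local Notation C := R[i].
Variables (n : nat) (a : int -> C).
Hypothesis a_herm : herm n a.
Hypothesis a_pd : posdefmx (toeplitz a n.+1).
Implicit Types (f g h : {poly C}) (b z xi : C).

Local Notation "<< f , g >>" := (ip n a f g).
Local Notation Q := (opuc a n).

(** If Q_n = (z - xi) k with xi on the circle, then z k = Q_n + xi k is an
    orthogonal decomposition, and Pythagoras contradicts the equality of the
    norms of z k and k. *)
Lemma opuc_circle_neq0 xi : `|xi| = 1 -> Q.[xi] != 0.
Proof.
move=> x1; apply/negP => Q0; pose k := Q %/ ('X - xi%:P).
have QE : 'X * k = Q + xi *: k.
  rewrite -[in RHS](divpK (d := 'X - xi%:P) (p := Q)) ?dvdp_XsubCl //.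
  by rewrite -/k mulrBr [k * _%:P]mulrC mul_polyC subrK mulrC.
have sk : size k = n.
  by rewrite size_divp ?polyXsubC_eq0 // size_XsubC subn1 (size_opuc a_pd).
have Qk : <<Q, k>> = 0.
  by rewrite -(ip_conj a_herm) (ip_opuc a_pd) ?sk // rmorph0.
have := ip_shift a (leqW (eq_leq sk)) (leqW (eq_leq sk)).
rewrite QE ipDl !ipDr !(ipZl _ _ _ xi) !(ipZr _ _ _ xi).
rewrite Qk (ip_opuc a_pd (leqnn n) (eq_leq sk)) !mulr0 !(addr0, add0r).
rewrite mulrA [_^* * _]mulrC -normCK x1 expr1n mul1r => /eqP.
by rewrite -subr_eq0 addrK gt_eqF ?(ip_opuc_gt0 a_pd).
Qed.

Lemma hweight_ip b xi : `|b| = 1 -> root (paraorth n a b) xi ->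
  hweight n a b xi = << paraorth n a b %/ ('X - xi%:P), paraorth n a b %/ ('X - xi%:P) >>.
Proof. by move=> b1 Px; rewrite /hweight sqnorm_ip // (size_quotient a_pd). Qed.

Lemma hweight_gt0 b xi : `|b| = 1 -> root (paraorth n a b) xi -> 0 < hweight n a b xi.
Proof.
move=> b1 Px; rewrite hweight_ip //; apply: ip_gt0 => //.
  by rewrite (size_quotient a_pd).
exact: (quotient_neq0 a_pd Px).
Qed.

Lemma hweight_eval b xi : `|b| = 1 -> root (paraorth n a b) xi ->
  hweight n a b xi =
  ((paraorth n a b %/ ('X - xi%:P)).[xi])^* * <<1, paraorth n a b %/ ('X - xi%:P)>>.
Proof.
move=> b1 Px; rewrite hweight_ip // (ip_eval a_herm a_pd b1 Px) //.
by rewrite (size_quotient a_pd).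
Qed.

(** Both sides come from <f, g> = conj(f(xi)) <1, g>: f = g gives h_xi, and
    f = Q_n gives nu, because g is monic of degree n. *)
Lemma hweight_opuc b xi : `|b| = 1 -> root (paraorth n a b) xi ->
  hweight n a b xi * Q.[xi] = <<Q, Q>> * (paraorth n a b %/ ('X - xi%:P)).[xi].
Proof.
move=> b1 Px; set g := _ %/ _.
have sg : size g = n.+1 by exact: size_quotient.
have hE : hweight n a b xi = g.[xi] * <<1, g>>^*.
  rewrite hweight_ip // -(ip_conj a_herm) -hweight_ip // hweight_eval //.
  by rewrite rmorphM /= conjCK.
have nuE : <<Q, Q>> = Q.[xi] * <<1, g>>^*.
  rewrite -(ip_opuc_monic a_pd sg); last exact: (monic_quotient a_pd Px).
  rewrite -(ip_conj a_herm) (ip_eval a_herm a_pd b1 Px) ?(size_opuc a_pd) //.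
  by rewrite rmorphM /= conjCK.
by rewrite hE nuE; ring.
Qed.

(** The conjugate of K_(m-1)(z, xi) as a polynomial in z, truncated at m so that
    the reproducing property can be proved by induction. *)
Definition cdpoly m xi : {poly C} :=
  \sum_(i < m) ((opuc_norm n a i).[xi])^* *: opuc_norm n a i.

Lemma CDkernel_cdpoly xi z : CDkernel n a z xi = ((cdpoly n xi).[z])^*.
Proof.
rewrite horner_sum rmorph_sum; apply: eq_bigr => m _.
by rewrite (hornerZ _ (opuc_norm n a m)) rmorphM /= conjCK mulrC.
Qed.

Lemma size_cdpoly m xi : (m <= n)%N -> (size (cdpoly m xi) <= m)%N.
Proof.
move=> mn; apply: (leq_trans (size_sum _ _ _)); apply/bigmax_leqP => i _.
apply: (leq_trans (size_scale_leq _ _)); apply: (leq_trans (size_scale_leq _ _)).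
by rewrite (size_opuc a_pd) // (leq_trans (ltnW (ltn_ord i))).
Qed.

Lemma cdpolyS m xi : cdpoly m.+1 xi =
  cdpoly m xi + ((opuc_norm n a m).[xi])^* *: opuc_norm n a m.
Proof. by rewrite /cdpoly big_ord_recr. Qed.

(** Induction on m: subtract from f a multiple of the last basis element, which is
    orthogonal to what remains. *)
Lemma cdpoly_reproducing m xi f : (m <= n)%N -> (size f <= m)%N ->
  <<cdpoly m xi, f>> = f.[xi].
Proof.
elim: m f => [|m IH] f mn fm.
  by move: fm; rewrite leqn0 size_poly_eq0 => /eqP ->; rewrite ip0r horner0.
have mn' := ltnW mn.
set c := f`_m; pose q := opuc a m.
have qm : q`_m = 1.
  by have := monic_opuc a_pd mn'; rewrite monicE lead_coefE (size_opuc a_pd) //= => /eqP.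
pose f' := f - c *: q.
have f'm : (size f' <= m)%N.
  apply/leq_sizeP => j; rewrite leq_eqVlt coefB coefZ => /predU1P[<-|mj].
    by rewrite qm mulr1 subrr.
  by rewrite !nth_default ?mulr0 ?subrr ?(leq_trans fm) ?(size_opuc a_pd).
have -> : f = f' + c *: q by rewrite subrK.
clearbody f'.
have q'E : opuc_norm n a m = (sqrtC <<q, q>>)^-1 *: q.
  by rewrite /opuc_norm sqnorm_ip // (size_opuc a_pd).
have q0 : 0 < <<q, q>> by apply: (ip_opuc_gt0 a_pd).
have sq0 : 0 < sqrtC <<q, q>> by rewrite sqrtC_gt0.
(* The polynomial p is arbitrary because Q_m is itself a scalar multiple by
   definition, so that the scaling rules would also expand Q_m. *)
have key (p : {poly C}) d : d^* = d -> d != 0 -> d ^+ 2 = <<p, p>> ->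
    <<cdpoly m xi, p>> = 0 -> <<p, f'>> = 0 ->
    <<cdpoly m xi + ((d^-1 *: p).[xi])^* *: (d^-1 *: p), f' + c *: p>> =
    <<cdpoly m xi, f'>> + c * p.[xi].
  move=> dr d0 dp Kp pf; rewrite hornerZ ipDl !ipDr !ipZl !ipZr Kp pf -dp.
  by rewrite conjCK fmorphV /= dr; field.
rewrite cdpolyS q'E hornerD (hornerZ c) -(IH f' mn' f'm); apply: key.
- by apply: conj_Creal; rewrite realE (ltW sq0).
- by rewrite gt_eqF.
- by rewrite sqrtCK.
- by rewrite (ip_opuc a_pd mn' (size_cdpoly _ mn')).
- by rewrite -(ip_conj a_herm) (ip_opuc a_pd mn' f'm) rmorph0.
Qed.

End Kernel.

(** * Differentiation of complex-valued curves *)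

Section ComplexCurves.
Context {R : realType}.
Local Notation C := R[i].
Implicit Types (f g : R -> C) (t : R) (l m : C).

Definition is_cderive f t l : Prop :=
  is_derive t 1 (ReC f) (complex.Re l) /\ is_derive t 1 (ImC f) (complex.Im l).

Definition ccont f t : Prop :=
  {for t, continuous (ReC f)} /\ {for t, continuous (ImC f)}.

Lemma complex_ReM (x y : C) :
  complex.Re (x * y) = complex.Re x * complex.Re y - complex.Im x * complex.Im y.
Proof. by case: x => ? ?; case: y => ? ?. Qed.

Lemma complex_ImM (x y : C) :
  complex.Im (x * y) = complex.Re x * complex.Im y + complex.Im x * complex.Re y.
Proof. by case: x => ? ?; case: y => ? ?. Qed.

Lemma complex_ReD (x y : C) : complex.Re (x + y) = complex.Re x + complex.Re y.
Proof. by case: x => ? ?; case: y => ? ?. Qed.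

Lemma complex_ImD (x y : C) : complex.Im (x + y) = complex.Im x + complex.Im y.
Proof. by case: x => ? ?; case: y => ? ?. Qed.

Lemma complex_Re_conj (x : C) : complex.Re x^* = complex.Re x.
Proof. by case: x => ? ?. Qed.

Lemma complex_Im_conj (x : C) : complex.Im x^* = - complex.Im x.
Proof. by case: x => ? ?. Qed.

Lemma ReIm_eq (x y : C) :
  complex.Re x = complex.Re y -> complex.Im x = complex.Im y -> x = y.
Proof. by case: x => ? ?; case: y => ? ? /= -> ->. Qed.

Lemma is_cderiveE f t l : is_cderive f t l -> cderive f t = l.
Proof.
by move=> [fR fI]; apply: ReIm_eq => /=; rewrite derive1E; apply: derive_val.
Qed.

Lemma ReC_near f g t : (\forall s \near t, f s = g s) ->
  (\forall s \near t, ReC f s = ReC g s) /\ (\forall s \near t, ImC f s = ImC g s).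
Proof. by move=> fg; split; apply: filterS fg => s; rewrite /ReC /ImC => ->. Qed.

Lemma is_cderive_near f g t l : (\forall s \near t, f s = g s) ->
  is_cderive f t l -> is_cderive g t l.
Proof.
move=> /ReC_near [fgR fgI] [fR fI].
by split; [apply: near_eq_is_derive fgR fR|apply: near_eq_is_derive fgI fI].
Qed.

Lemma cont_near (f g : R -> R) t : (\forall s \near t, f s = g s) ->
  {for t, continuous f} -> {for t, continuous g}.
Proof.
move=> fg cf; rewrite /prop_for /continuous_at -(nbhs_singleton fg).
by apply: cvg_trans cf; apply: near_eq_cvg; apply: filterS fg => s ->.
Qed.

Lemma ccont_near f g t : (\forall s \near t, f s = g s) -> ccont f t -> ccont g t.
Proof.
move=> /ReC_near [fgR fgI] [fR fI].
by split; [exact: cont_near fgR fR|exact: cont_near fgI fI].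
Qed.

Lemma is_cderive_ccont f t l : is_cderive f t l -> ccont f t.
Proof.
move=> [[/derivable1_diffP fR _] [/derivable1_diffP fI _]].
by split; apply: differentiable_continuous.
Qed.

Lemma ccont_cst l t : ccont (fun=> l) t.
Proof. by split; apply: cst_continuous. Qed.

Lemma ccontD f g t : ccont f t -> ccont g t -> ccont (fun s => f s + g s) t.
Proof.
move=> [fR fI] [gR gI]; split.
  have -> : ReC (fun s => f s + g s) = fun s => ReC f s + ReC g s.
    by apply/funext => s; rewrite /ReC complex_ReD.
  exact: continuousD.
have -> : ImC (fun s => f s + g s) = fun s => ImC f s + ImC g s.
  by apply/funext => s; rewrite /ImC complex_ImD.
exact: continuousD.
Qed.

Lemma ccontM f g t : ccont f t -> ccont g t -> ccont (fun s => f s * g s) t.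
Proof.
move=> [fR fI] [gR gI]; split.
  have -> : ReC (fun s => f s * g s) = fun s => ReC f s * ReC g s - ImC f s * ImC g s.
    by apply/funext => s; rewrite /ReC complex_ReM.
  by apply: continuousB; apply: continuousM.
have -> : ImC (fun s => f s * g s) = fun s => ReC f s * ImC g s + ImC f s * ReC g s.
  by apply/funext => s; rewrite /ImC complex_ImM.
by apply: continuousD; apply: continuousM.
Qed.

Lemma ccont_conj f t : ccont f t -> ccont (fun s => (f s)^*) t.
Proof.
move=> [fR fI]; split.
  have -> // : ReC (fun s => (f s)^*) = ReC f.
  by apply/funext => s; rewrite /ReC complex_Re_conj.
have -> : ImC (fun s => (f s)^*) = fun s => - ImC f s.
  by apply/funext => s; rewrite /ImC complex_Im_conj.
exact: continuousN.
Qed.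

Lemma ccontN f t : ccont f t -> ccont (fun s => - f s) t.
Proof.
move=> cf; have := ccontM (ccont_cst (-1) t) cf.
by apply: ccont_near; near=> s; rewrite mulN1r.
Unshelve. all: by end_near. Qed.

Lemma complex_ReV (x : C) :
  complex.Re x^-1 = complex.Re x / (complex.Re x ^+ 2 + complex.Im x ^+ 2).
Proof. by case: x. Qed.

Lemma complex_ImV (x : C) :
  complex.Im x^-1 = - complex.Im x / (complex.Re x ^+ 2 + complex.Im x ^+ 2).
Proof. by case: x => u v /=; rewrite mulNr. Qed.

Lemma ccontV f t : f t != 0 -> ccont f t -> ccont (fun s => (f s)^-1) t.
Proof.
move=> f0 [fR fI]; pose d s := ReC f s ^+ 2 + ImC f s ^+ 2.
have d0 : d t != 0.
  rewrite /d paddr_eq0 ?sqr_ge0 // !sqrf_eq0; apply: contra f0.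
  by move=> /andP[/eqP Rf0 /eqP If0]; apply/eqP/ReIm_eq.
have cd : {for t, continuous (fun s => (d s)^-1)}.
  apply: continuousV => //; apply: continuousD; exact: continuousM.
split.
  have -> : ReC (fun s => (f s)^-1) = fun s => ReC f s * (d s)^-1.
    by apply/funext => s; rewrite /ReC complex_ReV.
  exact: continuousM.
have -> : ImC (fun s => (f s)^-1) = fun s => - ImC f s * (d s)^-1.
  by apply/funext => s; rewrite /ImC complex_ImV.
apply: continuousM; [exact: continuousN|exact: cd].
Qed.

Lemma ccont_sum (I : Type) (r : seq I) (F : I -> R -> C) t :
  (forall i, ccont (F i) t) -> ccont (fun s => \sum_(i <- r) F i s) t.
Proof.
move=> cF; elim: r => [|i r IH].
  by apply: ccont_near (ccont_cst 0 t); near=> s; rewrite big_nil.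
by apply: ccont_near (ccontD (cF i) IH); near=> s; rewrite big_cons.
Unshelve. all: by end_near. Qed.

Lemma is_cderive_cst l t : is_cderive (fun=> l) t 0.
Proof. by split; apply: is_derive_cst. Qed.

Lemma is_cderiveD f g t l m : is_cderive f t l -> is_cderive g t m ->
  is_cderive (fun s => f s + g s) t (l + m).
Proof.
move=> [fR fI] [gR gI]; split.
  have -> : ReC (fun s => f s + g s) = (ReC f + ReC g)%R.
    by apply/funext => s; rewrite /ReC complex_ReD.
  by rewrite complex_ReD; apply: is_deriveD.
have -> : ImC (fun s => f s + g s) = (ImC f + ImC g)%R.
  by apply/funext => s; rewrite /ImC complex_ImD.
by rewrite complex_ImD; apply: is_deriveD.
Qed.

Lemma is_cderiveM f g t l m : is_cderive f t l -> is_cderive g t m ->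
  is_cderive (fun s => f s * g s) t (l * g t + f t * m).
Proof.
move=> [fR fI] [gR gI]; split.
  have -> : ReC (fun s => f s * g s) = (ReC f * ReC g - ImC f * ImC g)%R.
    by apply/funext => s; rewrite /ReC complex_ReM.
  apply: (is_derive_eq (is_deriveB (is_deriveM fR gR) (is_deriveM fI gI))).
  by rewrite complex_ReD !complex_ReM /ReC /ImC /GRing.scale /=; ring.
have -> : ImC (fun s => f s * g s) = (ReC f * ImC g + ImC f * ReC g)%R.
  by apply/funext => s; rewrite /ImC complex_ImM.
apply: (is_derive_eq (is_deriveD (is_deriveM fR gI) (is_deriveM fI gR))).
by rewrite complex_ImD !complex_ImM /ReC /ImC /GRing.scale /=; ring.
Qed.

Lemma is_cderive_conj f t l : is_cderive f t l ->
  is_cderive (fun s => (f s)^*) t l^*.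
Proof.
move=> [fR fI]; split; rewrite ?complex_Re_conj ?complex_Im_conj.
  have -> // : ReC (fun s => (f s)^*) = ReC f.
  by apply/funext => s; rewrite /ReC complex_Re_conj.
have -> : ImC (fun s => (f s)^*) = (- ImC f)%R.
  by apply/funext => s; rewrite /ImC complex_Im_conj.
exact: is_deriveN.
Qed.

Lemma is_cderiveZ f t l (u : C) : is_cderive f t l ->
  is_cderive (fun s => u * f s) t (u * l).
Proof. by move=> /(is_cderiveM (is_cderive_cst u t)); rewrite mul0r add0r. Qed.

Lemma is_cderiveN f t l : is_cderive f t l -> is_cderive (fun s => - f s) t (- l).
Proof.
move=> /(is_cderiveZ (-1)); rewrite mulN1r; apply: is_cderive_near.
by near=> s; rewrite mulN1r.
Unshelve. all: by end_near. Qed.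

Lemma is_cderive_sum (I : Type) (r : seq I) (F : I -> R -> C) (L : I -> C) t :
  (forall i, is_cderive (F i) t (L i)) ->
  is_cderive (fun s => \sum_(i <- r) F i s) t (\sum_(i <- r) L i).
Proof.
move=> cF; elim: r => [|i r IH].
  rewrite big_nil; apply: is_cderive_near (is_cderive_cst 0 t).
  by near=> s; rewrite big_nil.
rewrite big_cons; apply: is_cderive_near (is_cderiveD (cF i) IH).
by near=> s; rewrite big_cons.
Unshelve. all: by end_near. Qed.

(** A factor that vanishes at t needs no differentiable partner: this is what
    makes implicit differentiation possible from continuity alone. *)
Lemma is_derive_mul_cont (F E : R -> R) t (l : R) :
  is_derive t 1 F l -> F t = 0 -> {for t, continuous E} ->
  is_derive t 1 (F * E)%R (l * E t).
Proof.
move=> [dF Fl] F0 cE.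
have E' : E (h *: 1 + t) @[h --> 0^'] --> E t.
  suff : {for 0, continuous (fun h : R => E (h *: 1 + t))}.
    by move=> /continuous_withinNx; rewrite scale0r add0r.
  apply: (@continuous_comp _ _ _ (fun h : R => h *: 1 + t) E).
    have -> : (fun h : R => h *: 1 + t) = idfun + cst t.
      by apply/funext => h /=; rewrite [h *: _]mulr1.
    by apply: continuousD; [exact: cvg_id|exact: cvg_cst].
  by rewrite scale0r add0r.
have H : h^-1 *: (((F * E)%R \o shift t) (h *: 1) - (F * E)%R t) @[h --> 0^'] --> l * E t.
  have -> : (fun h => h^-1 *: (((F * E)%R \o shift t) (h *: 1) - (F * E)%R t)) =
      fun h => (h^-1 *: ((F \o shift t) (h *: 1) - F t)) * E (h *: 1 + t).
    apply/funext => h; rewrite /= F0 subr0 -[(F * E)%R t]/(F t * E t) F0 mul0r subr0.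
    by rewrite -scalerAl.
  by apply: cvgM => //; rewrite -Fl; exact: dF.
split; first by apply/cvg_ex; exists (l * E t).
exact: cvg_lim H.
Qed.

Lemma is_cderive_mul_ccont (f g : R -> C) t l :
  is_cderive f t l -> f t = 0 -> ccont g t ->
  is_cderive (fun s => f s * g s) t (l * g t).
Proof.
move=> [fR fI] f0 [gR gI].
have fR0 : ReC f t = 0 by rewrite /ReC f0.
have fI0 : ImC f t = 0 by rewrite /ImC f0.
split.
  have -> : ReC (fun s => f s * g s) = (ReC f * ReC g - ImC f * ImC g)%R.
    by apply/funext => s; rewrite /ReC complex_ReM.
  by rewrite complex_ReM; apply: is_deriveB; apply: is_derive_mul_cont.
have -> : ImC (fun s => f s * g s) = (ReC f * ImC g + ImC f * ReC g)%R.
  by apply/funext => s; rewrite /ImC complex_ImM.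
by rewrite complex_ImM; apply: is_deriveD; apply: is_derive_mul_cont.
Qed.

Lemma ccont_neq0 f t : ccont f t -> f t != 0 -> \forall s \near t, f s != 0.
Proof.
move=> [fR fI] f0; pose d s := ReC f s ^+ 2 + ImC f s ^+ 2.
have dE s : (f s == 0) = (d s == 0).
  rewrite /d paddr_eq0 ?sqr_ge0 // !sqrf_eq0; apply/eqP/andP => [e|[/eqP a /eqP b]].
    by split; rewrite /ReC /ImC e eqxx.
  exact: ReIm_eq.
have cd : {for t, continuous d} by apply: continuousD; exact: continuousM.
have d0 : 0 < d t by rewrite lt_def -dE f0 addr_ge0 ?sqr_ge0.
have : \forall s \near t, 0 < d s by exact: (cvgr_gt _ cd).
by apply: filterS => s ds; rewrite dE gt_eqF.
Qed.

(** Write 1/f - 1/f(t) as (f - f(t)) times a continuous factor. *)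
Lemma is_cderiveV f t l : f t != 0 -> is_cderive f t l ->
  is_cderive (fun s => (f s)^-1) t (- (l / f t ^+ 2)).
Proof.
move=> f0 df; have cf := is_cderive_ccont df.
have dB : is_cderive (fun s => f s - f t) t l.
  by rewrite -[l]addr0; apply: is_cderiveD => //; exact: is_cderive_cst.
have cE : ccont (fun s => - ((f s)^-1 * (f t)^-1)) t.
  by apply: ccontN; apply: ccontM (ccont_cst _ _); apply: ccontV.
have := is_cderive_mul_ccont dB (subrr _) cE.
move=> /is_cderiveD /(_ (is_cderive_cst (f t)^-1 t)).
have -> : l * - ((f t)^-1 / f t) + 0 = - (l / f t ^+ 2).
  by rewrite addr0 mulrN expr2 invfM.
apply: is_cderive_near.
apply: filterS (ccont_neq0 cf f0) => s fs.
by field; rewrite fs f0.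
Qed.

End ComplexCurves.

Section C1Curves.
Context {R : realType}.
Local Notation C := R[i].
Variable J : set R.
Hypothesis J_open : open J.
Implicit Types (f g : R -> C) (t : R).

Lemma open_near (P : R -> Prop) t : J t -> (forall s, J s -> P s) ->
  \forall s \near t, P s.
Proof. by move=> Jt JP; apply: filterS JP _; exact: open_nbhs_nbhs. Qed.

(** On an open set the derivative near t is given by the same formula as at t,
    which is what transfers the continuity of f' to the derivative of f. *)
Lemma C1_onP (f f' : R -> R) :
  (forall t, J t -> is_derive t 1 f (f' t) /\ {for t, continuous f'}) -> C1_on J f.
Proof.
move=> H t Jt; have [[df _] cf'] := H t Jt; split; first exact: df.
apply: cont_near cf'; apply: open_near => // s Js.
by rewrite derive1E; have [[_ ->]] := H s Js.
Qed.

Lemma C1C_onP f (f' : R -> C) :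
  (forall t, J t -> is_cderive f t (f' t)) -> (forall t, J t -> ccont f' t) ->
  C1C_on J f.
Proof.
move=> df cf; split.
  by apply: (@C1_onP _ (ReC f')) => t Jt; split; [case: (df t Jt)|case: (cf t Jt)].
by apply: (@C1_onP _ (ImC f')) => t Jt; split; [case: (df t Jt)|case: (cf t Jt)].
Qed.

Lemma C1C_cderive f t : C1C_on J f -> J t -> is_cderive f t (cderive f t).
Proof.
move=> [fR fI] Jt; have [dR _] := fR t Jt; have [dI _] := fI t Jt.
split; rewrite /= derive1E; [exact: DeriveDef dR _|exact: DeriveDef dI _].
Qed.

Lemma C1C_ccont_cderive f t : C1C_on J f -> J t -> ccont (cderive f) t.
Proof.
move=> [fR fI] Jt; have [_ dR] := fR t Jt; have [_ dI] := fI t Jt.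
split; [exact: dR|exact: dI].
Qed.

Lemma C1C_ccont f t : C1C_on J f -> J t -> ccont f t.
Proof. by move=> fC Jt; exact: is_cderive_ccont (C1C_cderive fC Jt). Qed.

Lemma C1C_eq f g : (forall t, J t -> f t = g t) -> C1C_on J f -> C1C_on J g.
Proof.
move=> fg fC; apply: (@C1C_onP _ (cderive f)) => t Jt; last exact: C1C_ccont_cderive.
by apply: is_cderive_near (C1C_cderive fC Jt); exact: open_near.
Qed.

Lemma C1C_cst (u : C) : C1C_on J (fun=> u).
Proof.
by apply: (@C1C_onP _ (fun=> 0)) => t _; [exact: is_cderive_cst|exact: ccont_cst].
Qed.

Lemma C1C_D f g : C1C_on J f -> C1C_on J g -> C1C_on J (fun s => f s + g s).
Proof.
move=> fC gC; apply: (@C1C_onP _ (fun t => cderive f t + cderive g t)) => t Jt.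
  by apply: is_cderiveD; exact: C1C_cderive.
by apply: ccontD; exact: C1C_ccont_cderive.
Qed.

Lemma C1C_M f g : C1C_on J f -> C1C_on J g -> C1C_on J (fun s => f s * g s).
Proof.
move=> fC gC.
apply: (@C1C_onP _ (fun t => cderive f t * g t + f t * cderive g t)) => t Jt.
  by apply: is_cderiveM; exact: C1C_cderive.
by apply: ccontD; apply: ccontM; (exact: C1C_ccont_cderive || exact: C1C_ccont).
Qed.

Lemma C1C_conj f : C1C_on J f -> C1C_on J (fun s => (f s)^*).
Proof.
move=> fC; apply: (@C1C_onP _ (fun t => (cderive f t)^*)) => t Jt.
  by apply: is_cderive_conj; exact: C1C_cderive.
by apply: ccont_conj; exact: C1C_ccont_cderive.
Qed.

Lemma C1C_V f : (forall t, J t -> f t != 0) -> C1C_on J f ->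
  C1C_on J (fun s => (f s)^-1).
Proof.
move=> f0 fC; apply: (@C1C_onP _ (fun t => - (cderive f t / f t ^+ 2))) => t Jt.
  by apply: is_cderiveV; [exact: f0|exact: C1C_cderive].
apply: ccontN; apply: ccontM; first exact: C1C_ccont_cderive.
apply: ccontV; first by rewrite expf_neq0 ?f0.
by apply: ccontM; exact: C1C_ccont.
Qed.

Lemma C1C_sum (I : Type) (r : seq I) (F : I -> R -> C) :
  (forall i, C1C_on J (F i)) -> C1C_on J (fun s => \sum_(i <- r) F i s).
Proof.
move=> FC; elim: r => [|i r IH].
  by apply: C1C_eq (C1C_cst 0) => s _; rewrite big_nil.
by apply: C1C_eq (C1C_D (FC i) IH) => s _; rewrite big_cons.
Qed.

End C1Curves.

(** * Curves of polynomials and of their roots *)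

Section PolynomialCurves.
Context {R : realType}.
Local Notation C := R[i].
Implicit Types (p q : R -> {poly C}) (t : R).

(** Derivative in the parameter of a polynomial whose argument is held fixed. *)
Definition pderive p t (p' : {poly C}) : Prop :=
  forall k, is_cderive (fun s => (p s)`_k) t p'`_k.

Lemma pderive_horner N p t (p' : {poly C}) (z : C) :
  (\forall s \near t, (size (p s) <= N)%N) -> (size p' <= N)%N ->
  pderive p t p' -> is_cderive (fun s => (p s).[z]) t p'.[z].
Proof.
move=> sp sp' dp; rewrite (horner_coef_wide _ sp').
have : is_cderive (fun s => \sum_(k < N) z ^+ k * (p s)`_k) t
    (\sum_(k < N) z ^+ k * p'`_k).
  by apply: is_cderive_sum => k; apply: is_cderiveZ.
under [X in is_cderive _ _ X]eq_bigr => k _ do rewrite mulrC.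
apply: is_cderive_near; apply: filterS sp => s ps.
by rewrite (horner_coef_wide _ ps); apply: eq_bigr => k _; rewrite mulrC.
Qed.

(** The divided difference (p(y) - p(x)) / (y - x), as a polynomial in y whose
    coefficients are visibly continuous in p and x; at a root x it is the
    quotient of p by 'X - x ([ddiff_quotient]). *)
Definition ddiff N (p : {poly C}) (x : C) : {poly C} :=
  \sum_(k < N) p`_k *: \sum_(i < k) (x ^+ i) *: 'X^(k.-1 - i).

Lemma ddiffE N (p : {poly C}) (x : C) : (size p <= N)%N ->
  p - (p.[x])%:P = ('X - x%:P) * ddiff N p x.
Proof.
move=> sp; rewrite (horner_coef_wide _ sp) rmorph_sum /=.
have {1}-> : p = \sum_(k < N) p`_k *: 'X^k.
  rewrite -poly_def; apply/polyP => k; rewrite coef_poly; case: ltnP => // Nk.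
  by rewrite nth_default ?(leq_trans sp).
rewrite -sumrB mulr_sumr; apply: eq_bigr => k _.
rewrite polyCM mul_polyC -scalerBr -scalerAr; congr (_ *: _).
rewrite polyC_exp subrXX; congr (_ * _); apply: eq_bigr => i _.
by rewrite -polyC_exp mulrC mul_polyC.
Qed.

Lemma ddiff_root N (p : {poly C}) (x y : C) : (size p <= N)%N ->
  root p x -> p.[y] = (y - x) * (ddiff N p x).[y].
Proof.
move=> sp /eqP px; have := congr1 (horner^~ y) (ddiffE x sp).
by rewrite /= px subr0 hornerM hornerXsubC.
Qed.

Lemma ddiff_quotient N (p : {poly C}) (x : C) : (size p <= N)%N ->
  root p x -> ddiff N p x = p %/ ('X - x%:P).
Proof.
move=> sp px; have := ddiffE x sp; move/eqP: (px) => ->; rewrite subr0.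
by move=> {2}->; rewrite mulrC mulpK // polyXsubC_eq0.
Qed.

Lemma ccont_ddiff N p t (x y : R -> C) :
  (forall k, ccont (fun s => (p s)`_k) t) -> ccont x t -> ccont y t ->
  ccont (fun s => (ddiff N (p s) (x s)).[y s]) t.
Proof.
have ccontX (f : R -> C) k : ccont f t -> ccont (fun s => f s ^+ k) t.
  move=> cf; elim: k => [|k IH].
    by apply: ccont_near (ccont_cst 1 t); near=> s; rewrite expr0.
  by apply: ccont_near (ccontM cf IH); near=> s; rewrite exprS.
move=> cp cx cy.
have : ccont (fun s => \sum_(k < N) (p s)`_k *
    \sum_(i < k) x s ^+ i * y s ^+ (k.-1 - i)) t.
  apply: ccont_sum => k; apply: ccontM (cp k) _; apply: ccont_sum => i.
  by apply: ccontM; exact: ccontX.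
apply: ccont_near; near=> s; rewrite horner_sum; apply: eq_bigr => k _.
rewrite hornerZ horner_sum; congr (_ * _); apply: eq_bigr => i _.
by rewrite hornerZ hornerXn.
Unshelve. all: by end_near. Qed.

Lemma ccont_horner N p t (x : R -> C) :
  (\forall s \near t, (size (p s) <= N)%N) ->
  (forall k, ccont (fun s => (p s)`_k) t) -> ccont x t ->
  ccont (fun s => (p s).[x s]) t.
Proof.
move=> sp cp cx.
have : ccont (fun s => (p s)`_0 + x s * (ddiff N (p s) 0).[x s]) t.
  apply: ccontD; first exact: cp.
  apply: ccontM; first exact: cx.
  by apply: ccont_ddiff; [exact: cp|exact: ccont_cst|exact: cx].
apply: ccont_near; apply: filterS sp => s ps.
have := congr1 (horner^~ (x s)) (ddiffE 0 ps).
rewrite /= hornerD hornerN hornerC hornerM subr0 hornerX horner_coef0 => <-.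
by rewrite addrC subrK.
Qed.

(** Implicit differentiation: with D(s) the divided difference of p(s) between
    x(t) and x(s), one has x(s) - x(t) = - p(s)(x(t)) / D(s), where the numerator
    vanishes at t and the denominator is continuous and tends to D(t) <> 0. *)
Lemma root_branch_derive N p t (p' : {poly C}) (x : R -> C) :
  (\forall s \near t, (size (p s) <= N)%N) -> (size p' <= N)%N ->
  pderive p t p' -> ccont x t -> (\forall s \near t, root (p s) (x s)) ->
  (p t %/ ('X - (x t)%:P)).[x t] != 0 ->
  is_cderive x t (- (p'.[x t] / (p t %/ ('X - (x t)%:P)).[x t])).
Proof.
move=> sp sp' dp cx px; have spt := nbhs_singleton sp; have pxt := nbhs_singleton px.
rewrite -(ddiff_quotient spt pxt) => g0.
pose E s := - ((ddiff N (p s) (x t)).[x s])^-1.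
have cp k : ccont (fun s => (p s)`_k) t by exact: is_cderive_ccont (dp k).
have cD : ccont (fun s => (ddiff N (p s) (x t)).[x s]) t.
  by apply: ccont_ddiff; [exact: cp|exact: ccont_cst|exact: cx].
have cE : ccont E t by apply: ccontN; apply: ccontV; [exact: g0|exact: cD].
have := is_cderive_mul_ccont (pderive_horner (x t) sp sp' dp) (eqP pxt) cE.
move=> /is_cderiveD /(_ (is_cderive_cst (x t) t)).
rewrite addr0 mulrN; apply: is_cderive_near.
apply: filterS3 sp px (ccont_neq0 cD g0) => s sps pxs Ds.
have := congr1 (horner^~ (x s)) (ddiffE (x t) sps).
rewrite /= hornerD hornerN hornerC hornerM (eqP pxs) hornerXsubC add0r => e.
by rewrite /E mulrN -mulNr e mulfK // subrK.
Qed.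

Lemma is_cderive_ip n (a : R -> int -> C) (a' : int -> C) p q t (p' q' : {poly C}) :
  (forall j, (`|j| <= n)%N -> is_cderive (fun s => a s j) t (a' j)) ->
  pderive p t p' -> pderive q t q' ->
  is_cderive (fun s => ip n (a s) (p s) (q s)) t
    (ip n a' (p t) (q t) + (ip n (a t) p' (q t) + ip n (a t) (p t) q')).
Proof.
move=> da dp dq; rewrite /ip -!big_split /=.
apply: is_cderive_sum => r; rewrite -!big_split /=; apply: is_cderive_sum => s.
have dtr : is_cderive (fun u => trunc n (a u) (r%:Z - s%:Z)) t (trunc n a' (r%:Z - s%:Z)).
  by rewrite /trunc; case: ifP => [/da|_] //; exact: is_cderive_cst.
have := is_cderiveM (is_cderiveM (is_cderive_conj (dp r)) (dq s)) dtr.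
by congr (is_cderive _ _ _); ring.
Qed.

Lemma pderive_cst (p : {poly C}) t : pderive (fun=> p) t 0.
Proof. by move=> k; rewrite coef0; exact: is_cderive_cst. Qed.

End PolynomialCurves.

Section PolynomialC1.
Context {R : realType}.
Local Notation C := R[i].
Variable J : set R.
Hypothesis J_open : open J.
Implicit Types (p q : R -> {poly C}) (t : R).

Definition C1poly p : Prop := forall k, C1C_on J (fun s => (p s)`_k).

Lemma C1poly_cst (p : {poly C}) : C1poly (fun=> p).
Proof. by move=> k; exact: C1C_cst. Qed.

Lemma C1polyM p q : C1poly p -> C1poly q -> C1poly (fun s => p s * q s).
Proof.
move=> Cp Cq k.
have H : C1C_on J (fun s => \sum_(i < k.+1) (p s)`_i * (q s)`_(k - i)).
  by apply: C1C_sum => // i; apply: C1C_M.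
by apply: C1C_eq H => // t _; rewrite coefM.
Qed.

Lemma C1poly_sum (I : Type) (r : seq I) (F : I -> R -> {poly C}) :
  (forall i, C1poly (F i)) -> C1poly (fun s => \sum_(i <- r) F i s).
Proof.
move=> CF k; have H : C1C_on J (fun s => \sum_(i <- r) (F i s)`_k).
  by apply: C1C_sum => // i; exact: CF.
by apply: C1C_eq H => // t _; rewrite coef_sum.
Qed.

Lemma C1poly_prod (I : Type) (r : seq I) (F : I -> R -> {poly C}) :
  (forall i, C1poly (F i)) -> C1poly (fun s => \prod_(i <- r) F i s).
Proof.
move=> CF; elim: r => [|i r IH] k.
  by apply: C1C_eq (C1poly_cst 1 k) => // t _; rewrite big_nil.
by apply: C1C_eq (C1polyM (CF i) IH k) => // t _; rewrite big_cons.
Qed.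

Lemma C1poly_det m (A : R -> 'M[{poly C}]_m) :
  (forall i j, C1poly (fun s => A s i j)) -> C1poly (fun s => \det (A s)).
Proof.
move=> CA; apply: C1poly_sum => s; apply: C1polyM; first exact: C1poly_cst.
by apply: C1poly_prod.
Qed.

(** Embedding the entries as constant polynomials reduces this to the previous
    lemma. *)
Lemma C1C_det m (A : R -> 'M[C]_m) :
  (forall i j, C1C_on J (fun s => A s i j)) -> C1C_on J (fun s => \det (A s)).
Proof.
move=> CA; have H : C1poly (fun s => \det (map_mx polyC (A s))).
  apply: C1poly_det => i j k.
  have [->|/negPf k0] := eqVneq k 0%N.
    by apply: C1C_eq (CA i j) => // t _; rewrite mxE coefC.
  by apply: C1C_eq (C1C_cst J_open 0) => // t _; rewrite mxE coefC k0.
by apply: C1C_eq (H 0%N) => // t _; rewrite det_map_mx coefC.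
Qed.

End PolynomialC1.

(** * Differentiating the orthogonality relations *)

Section Flow.
Context {R : realType}.
Local Notation C := R[i].
Variables (n : nat) (J : set R) (c : nat -> R -> C) (b : R -> C).
Hypothesis J_open : open J.
Hypothesis c_C1 : forall j, (j <= n)%N -> C1C_on J (c j).
Hypothesis c0_real : forall t, J t -> c 0%N t \is Num.real.
Hypothesis C_posdef : forall t, J t -> posdefmx (toeplitz (moments c t) n.+1).
Hypothesis b_C1 : C1C_on J b.
Hypothesis b_circle : forall t, J t -> `|b t| = 1.

Local Notation Q t := (opuc (moments c t) n).
Local Notation P t := (paraorth n (moments c t) (b t)).
Local Notation adot t := (fun j => cderive (moment c j) t).

Lemma moment_C1 j : (`|j| <= n)%N -> C1C_on J (moment c j).
Proof.
by case: j => j /= jn; [exact: c_C1|exact: (C1C_conj J_open (c_C1 jn))].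
Qed.

Lemma moment_herm t : J t -> herm n (moments c t).
Proof.
move=> Jt [[|j]|j] jn; rewrite /moments.
- by rewrite oppr0 /=; apply/esym/conj_Creal/c0_real.
- by rewrite -NegzE.
- by rewrite NegzE opprK /= conjCK.
Qed.

Lemma cderive_moment_herm t : J t -> herm n (adot t).
Proof.
move=> Jt j jn; apply: is_cderiveE.
apply: is_cderive_near (is_cderive_conj (C1C_cderive (moment_C1 jn) Jt)).
by apply: (open_near J_open Jt) => s Js; have := moment_herm Js jn.
Qed.

Lemma toeplitz_C1 m : (m <= n.+1)%N ->
  C1C_on J (fun t => \det (toeplitz (moments c t) m)).
Proof.
move=> mn; apply: (C1C_det J_open) => r s.
have jn : (`|r%:Z - s%:Z| <= n)%N by have := ltn_ord r; have := ltn_ord s; lia.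
by apply: C1C_eq (moment_C1 jn) => // t _; rewrite mxE.
Qed.

Lemma opuc_C1 m : (m <= n)%N -> C1poly J (fun t => opuc (moments c t) m).
Proof.
move=> mn k; pose M t : 'M[{poly C}]_m.+1 := \matrix_(r < m.+1, s < m.+1)
  (if (r < m)%N then (moments c t (r%:Z - s%:Z))%:P else 'X^s).
have CM : C1poly J (fun t => \det (M t)).
  apply: C1poly_det => // r s l.
  have [rm|mr] := ltnP r m; last first.
    by apply: C1C_eq (C1C_cst J_open ('X^s)`_l) => // t _; rewrite mxE ltnNge mr.
  have jn : (`|r%:Z - s%:Z| <= n)%N by have := ltn_ord s; lia.
  have [->|/negPf l0] := eqVneq l 0%N.
    by apply: C1C_eq (moment_C1 jn) => // t _; rewrite mxE rm coefC.
  by apply: C1C_eq (C1C_cst J_open 0) => // t _; rewrite mxE rm coefC l0.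
have d0 t : J t -> \det (toeplitz (moments c t) m) != 0.
  by move=> Jt; apply: det_toeplitz_neq0 (C_posdef Jt) (leqW mn).
have CV := C1C_V J_open d0 (toeplitz_C1 (leqW mn)).
by apply: C1C_eq (C1C_M J_open CV (CM k)) => // t _; rewrite /opuc coefZ.
Qed.

(** The t-derivative of Q_n. The leading coefficient is constant, so the degree
    drops below n. *)
Definition opuc_dot t : {poly C} := \poly_(k < n) cderive (fun s => (Q s)`_k) t.

Lemma pderive_opuc t : J t -> pderive (fun s => Q s) t (opuc_dot t).
Proof.
move=> Jt k; rewrite coef_poly; case: ltnP => kn.
  exact: C1C_cderive (opuc_C1 (leqnn n) k) Jt.
apply: is_cderive_near (is_cderive_cst ((Q t)`_k) t).
apply: (open_near J_open Jt) => s Js.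
have Qk u : J u -> (Q u)`_k = (k == n)%:R.
  move=> Ju; have sQ := size_opuc (C_posdef Ju) (leqnn n).
  have [->|kn'] := eqVneq k n; last by rewrite nth_default // sQ ltn_neqAle eq_sym kn'.
  by have := monic_opuc (C_posdef Ju) (leqnn n); rewrite monicE lead_coefE sQ => /eqP.
by rewrite !Qk.
Qed.

Lemma pderive_reversed p t (p' : {poly C}) :
  pderive p t p' -> pderive (fun s => reversed n (p s)) t (reversed n p').
Proof.
move=> dp k; rewrite coef_poly; case: ltnP => kn; last first.
  apply: is_cderive_near (is_cderive_cst 0 t).
  by near=> s; rewrite coef_poly ltnNge kn.
apply: is_cderive_near (is_cderive_conj (dp (n - k)%N)).
by near=> s; rewrite coef_poly kn.
Unshelve. all: by end_near. Qed.

Definition paraorth_dot t : {poly C} :=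
  'X * opuc_dot t - ((cderive b t)^* *: reversed n (Q t) +
                     (b t)^* *: reversed n (opuc_dot t)).

Lemma size_opuc_dot t : (size (opuc_dot t) <= n)%N.
Proof. exact: size_poly. Qed.

Lemma size_paraorth_dot t : (size (paraorth_dot t) <= n.+1)%N.
Proof.
rewrite /paraorth_dot (leq_trans (size_polyD _ _)) // geq_max; apply/andP; split.
  rewrite (leq_trans (size_polyMleq _ _)) // size_polyX /=.
  by rewrite ltnS size_opuc_dot.
rewrite size_polyN (leq_trans (size_polyD _ _)) // geq_max.
by apply/andP; split; apply: leq_trans (size_scale_leq _ _) (size_reversed _ _).
Qed.

Lemma pderive_paraorth t : J t -> pderive (fun s => P s) t (paraorth_dot t).
Proof.
move=> Jt k; have dQ := pderive_opuc Jt.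
have db := is_cderive_conj (C1C_cderive b_C1 Jt).
have dX : is_cderive (fun s => ('X * Q s)`_k) t ('X * opuc_dot t)`_k.
  rewrite coefXM; case: eqP => k0.
    by apply: is_cderive_near (is_cderive_cst 0 t); near=> s; rewrite coefXM k0.
  apply: is_cderive_near (dQ k.-1); near=> s; rewrite coefXM.
  by case: eqP.
have := is_cderiveD dX (is_cderiveN (is_cderiveM db (pderive_reversed dQ k))).
rewrite /paraorth_dot coefB coefD !coefZ; apply: is_cderive_near.
by near=> s; rewrite /paraorth coefB coefZ.
Unshelve. all: by end_near. Qed.

(** The branch moves tangentially to the circle: xi' = i theta' xi. *)
Lemma cderive_expi (f : R -> C) theta t : C1_argument J f theta -> J t ->
  cderive f t = 'i * (derive1 theta t)%:C%C * f t.
Proof.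
move=> [thC fE] Jt; apply: is_cderiveE.
have [dth _] := thC t Jt.
have Dth : is_derive t 1 theta (derive1 theta t).
  by rewrite derive1E; exact: DeriveDef dth erefl.
have -> : 'i * (derive1 theta t)%:C%C * f t =
   Complex (- sin (theta t) * derive1 theta t) (cos (theta t) * derive1 theta t).
  by rewrite fE // -complexiE; apply: ReIm_eq; rewrite /expi /=; ring.
apply: (@is_cderive_near _ (expi \o theta)).
  by apply: (open_near J_open Jt) => s Js; rewrite /= -fE.
split.
  have -> : ReC (expi \o theta) = cos \o theta by apply/funext.
  exact: is_derive1_comp (is_derive_cos _) Dth.
have -> : ImC (expi \o theta) = sin \o theta by apply/funext.
exact: is_derive1_comp (is_derive_sin _) Dth.
Qed.

Lemma cderive_branch xi t : zero_branch n c b J xi -> J t ->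
  cderive xi t * (P t %/ ('X - (xi t)%:P)).[xi t] = - (paraorth_dot t).[xi t].
Proof.
move=> [xiC xiP] Jt; have [xi1 Pxi] := xiP t Jt.
have g0 := quotient_at_root_neq0 (moment_herm Jt) (C_posdef Jt) (b_circle Jt) Pxi.
have sP : \forall s \near t, (size (P s) <= n.+2)%N.
  apply: (open_near J_open Jt) => s Js.
  by rewrite (size_paraorth (C_posdef Js)).
have rP : \forall s \near t, root (P s) (xi s).
  by apply: (open_near J_open Jt) => s Js; have [] := xiP s Js.
have := root_branch_derive sP (leqW (size_paraorth_dot t)) (pderive_paraorth Jt)
  (C1C_ccont xiC Jt) rP g0.
by move=> /is_cderiveE ->; rewrite mulNr divfK.
Qed.

Lemma in_Lambda_cdpoly t (z0 : C) : J t ->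
  in_Lambda n (fun z => ((cdpoly n (moments c t) n z0).[z])^* * (Q t).[z]).
Proof.
move=> Jt; have sk := size_cdpoly (C_posdef Jt) z0 (leqnn n).
have sQ := size_opuc (C_posdef Jt) (leqnn n).
by have [] := functional_ip_small (moments c t) (leqW sk) (eq_leq sQ).
Qed.

Lemma is_cderive_eq0 (f : R -> C) t l : J t -> (forall s, J s -> f s = 0) ->
  is_cderive f t l -> l = 0.
Proof.
move=> Jt f0 df; rewrite -[RHS](is_cderiveE (is_cderive_cst 0 t)).
by apply/esym/is_cderiveE/(is_cderive_near _ df)/(open_near J_open Jt).
Qed.

(** Differentiate <f, Q_n> = 0 with f fixed. *)
Lemma Ldot_opuc t (f : {poly C}) : J t -> (size f <= n)%N ->
  Ldot n c t (fun z => (f.[z])^* * (Q t).[z]) = - ip n (moments c t) f (opuc_dot t).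
Proof.
move=> Jt sf; have sQ := size_opuc (C_posdef Jt) (leqnn n).
rewrite /Ldot (functional_ip_small _ (leqW sf) (eq_leq sQ)).2.
have da j : (`|j| <= n)%N -> is_cderive (fun s => moments c s j) t (adot t j).
  by move=> jn; exact: C1C_cderive (moment_C1 jn) Jt.
have := is_cderive_ip da (pderive_cst f t) (pderive_opuc Jt).
rewrite ip0l add0r => /(is_cderive_eq0 Jt) H.
apply/eqP; rewrite -addr_eq0; apply/eqP/H => s Js.
by rewrite (ip_opuc (C_posdef Js)).
Qed.

(** Differentiate <P, z h> = 0 with h fixed. The absence of a constant term in
    z h keeps conj(P) z h inside Lambda_n, although P has degree n + 1. *)
Lemma Ldot_paraorth t (h : {poly C}) : J t -> (size h <= n)%N ->
  in_Lambda n (fun z => (('X * h).[z]) * ((P t).[z])^*) /\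
  Ldot n c t (fun z => (('X * h).[z]) * ((P t).[z])^*) =
  - ip n (moments c t) (paraorth_dot t) ('X * h).
Proof.
move=> Jt sh; have sP := size_paraorth (C_posdef Jt) (b t).
have sXh : (size ('X * h)%R <= n.+1)%N.
  rewrite (leq_trans (size_polyMleq _ _)) // size_polyX /=.
  by rewrite ltnS.
have coefs r s : (P t)`_r != 0 -> ('X * h)`_s != 0 -> (r <= s + n)%N && (s <= r + n)%N.
  move=> Pr hs; have rn : (r < n.+2)%N.
    by rewrite -sP ltnNge; apply: contra Pr => ?; rewrite nth_default.
  have sn : (s < n.+1)%N.
    by rewrite ltnNge; apply: contra hs => ?; rewrite nth_default // (leq_trans sXh).
  have s0 : (0 < s)%N by rewrite lt0n; apply: contra hs => /eqP->; rewrite coefXM.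
  by apply/andP; split; lia.
have [PL fE] := functional_ip (adot t) (eq_leq sP) (leqW sXh) coefs.
split.
  by apply: in_Lambda_eq PL => z _; rewrite mulrC.
have -> : Ldot n c t (fun z => ('X * h).[z] * ((P t).[z])^*) =
    functional n (adot t) (fun z => ((P t).[z])^* * ('X * h).[z]).
  by apply: functional_eq => z _; rewrite mulrC.
rewrite fE.
have da j : (`|j| <= n)%N -> is_cderive (fun s => moments c s j) t (adot t j).
  by move=> jn; exact: C1C_cderive (moment_C1 jn) Jt.
have := is_cderive_ip da (pderive_paraorth Jt) (pderive_cst ('X * h) t).
rewrite ip0r addr0 => /(is_cderive_eq0 Jt) H.
apply/eqP; rewrite -addr_eq0; apply/eqP/H => s Js.
rewrite -(ip_conj (moment_herm Js)).
by rewrite (ip_paraorth (moment_herm Js) (C_posdef Js)) ?rmorph0.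
Qed.

End Flow.

(** * The velocity formulas *)

Section FlowFormulas.
Context {R : realType}.
Local Notation C := R[i].
Variables (n : nat) (J : set R) (c : nat -> R -> C) (b : R -> C).
Hypothesis J_open : open J.
Hypothesis c_C1 : forall j, (j <= n)%N -> C1C_on J (c j).
Hypothesis c0_real : forall t, J t -> c 0%N t \is Num.real.
Hypothesis C_posdef : forall t, J t -> posdefmx (toeplitz (moments c t) n.+1).
Hypothesis b_C1 : C1C_on J b.
Hypothesis b_circle : forall t, J t -> `|b t| = 1.

Local Notation Q t := (opuc (moments c t) n).
Local Notation P t := (paraorth n (moments c t) (b t)).
Local Notation nu t := (sqnorm n (moments c t) (Q t)).


Lemma sqnorm_opuc_real t : J t -> nu t \is Num.real.
Proof.
move=> Jt; rewrite sqnorm_ip ?(size_opuc (C_posdef Jt)) //.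
by rewrite realE ltW ?(ip_opuc_gt0 (C_posdef Jt)).
Qed.

(** The imaginary part spelled out as a combination of a function and its
    conjugate, to which linearity applies. *)
Lemma VfunE t z0 z : Vfun n (moments c t) z0 z =
  (- 'i * nu t / (Q t).[z0]) *
    (((cdpoly n (moments c t) n z0).[z])^* * (Q t).[z]) +
  ('i * nu t / ((Q t).[z0])^*) *
    (((cdpoly n (moments c t) n z0).[z])^* * (Q t).[z])^*.
Proof.
have ImEn (x u : C) : 2 * u * 'Im x = u * 'i * (x^* - x).
  by rewrite ImE; field.
rewrite /Vfun ImEn CDkernel_cdpoly !rmorphM /= fmorphV /= conjCK; ring.
Qed.

Lemma Vfun_properties t z0 : J t -> `|z0| = 1 ->
  [/\ in_Lambda n (Vfun n (moments c t) z0), real_on_circle (Vfun n (moments c t) z0)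
    & Ldot n c t (Vfun n (moments c t) z0) =
      'i * nu t * ((opuc_dot n c t).[z0] / (Q t).[z0] -
                   ((opuc_dot n c t).[z0] / (Q t).[z0])^*)].
Proof.
move=> Jt z1; pose w z := ((cdpoly n (moments c t) n z0).[z])^* * (Q t).[z].
have wL : in_Lambda n w := in_Lambda_cdpoly C_posdef z0 Jt.
have [wcL wcE] := functional_conj wL.
pose u := - 'i * nu t / (Q t).[z0]; pose v := 'i * nu t / ((Q t).[z0])^*.
have [VL VE] := functional_lin u v wL wcL.
have VV z : u * w z + v * (w z)^* = Vfun n (moments c t) z0 z by rewrite VfunE.
split.
- by apply: in_Lambda_eq VL => z _; exact: VV.
- by move=> z _; rewrite rpredM ?Creal_Im // rpredM ?sqnorm_opuc_real ?realn.
- have -> : Ldot n c t (Vfun n (moments c t) z0) =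
      functional n (fun j => cderive (moment c j) t) (fun z => u * w z + v * (w z)^*).
    by apply: functional_eq => z _; rewrite VV.
  rewrite VE (wcE _ (cderive_moment_herm J_open c_C1 c0_real Jt)).
  have sk := size_cdpoly (C_posdef Jt) z0 (leqnn n).
  have -> : functional n (fun j => cderive (moment c j) t) w = - (opuc_dot n c t).[z0].
    rewrite -[LHS]/(Ldot n c t w) (Ldot_opuc J_open c_C1 C_posdef Jt sk).
    rewrite (cdpoly_reproducing (moment_herm c0_real Jt) (C_posdef Jt)) //.
    exact: size_opuc_dot.
  by rewrite rmorphM /= fmorphV rmorphN /= /u /v; ring.
Qed.

(** The algebra behind the velocity formula. Here q and d stand for the values
    at xi of Q_n and of its t-derivative, qc and dc for their conjugates, B for
    conj(b) and X for xi^n, so that the first equation says P(xi) = 0 and the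
    last one is the differentiated equation P(xi) = 0. Using the first equation
    to eliminate B is what produces the imaginary part of d / q. *)
Lemma velocity_identity (F : fieldType) (i xi q qc d dc B X nu h g th be : F) :
  i != 0 -> xi != 0 -> q != 0 -> qc != 0 -> i * i = -1 ->
  xi * q = B * (X * qc) -> h * q = nu * g ->
  i * th * xi * g = - (xi * d - (- (i * be * B) * (X * qc) + B * (X * dc))) ->
  h * th = - nu * be + i * nu * (d / q - dc / qc).
Proof.
move=> i0 xi0 q0 qc0 ii xq hq E.
apply: (mulfI (x := i * xi * q * qc)); first by rewrite !mulf_neq0.
have -> : i * xi * q * qc * (h * th) = xi * qc * i * th * (h * q) by ring.
rewrite hq; have -> : xi * qc * i * th * (nu * g) = nu * qc * (i * th * xi * g) by ring.
rewrite E.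
have -> : - (i * be * B) * (X * qc) = - (i * be * (xi * q)) by rewrite xq; ring.
have -> : nu * qc * - (xi * d - (- (i * be * (xi * q)) + B * (X * dc))) =
  nu * - (xi * d * qc + i * be * (xi * q) * qc - (B * (X * qc)) * dc) by ring.
rewrite -xq.
have -> : i * xi * q * qc * (- nu * be + i * nu * (d / q - dc / qc)) =
  - (i * xi * q * qc * nu * be) + (i * i) * xi * nu * (d * qc - dc * q).
  by field; rewrite q0 qc0.
by rewrite ii; ring.
Qed.

Lemma branch_formula (beta theta : R -> R) (xi : R -> C) t :
  C1_argument J b beta -> zero_branch n c b J xi -> C1_argument J xi theta -> J t ->
  hweight n (moments c t) (b t) (xi t) * (derive1 theta t)%:C%C =
  - nu t * (derive1 beta t)%:C%C + Ldot n c t (Vfun n (moments c t) (xi t)).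
Proof.
move=> bA xiB xiA Jt; have [xi1 Pxi] := xiB.2 t Jt.
have [_ _ ->] := Vfun_properties Jt xi1.
have q0 : (Q t).[xi t] != 0 :=
  opuc_circle_neq0 (moment_herm c0_real Jt) (C_posdef Jt) xi1.
have x0 : xi t != 0 by rewrite -normr_eq0 xi1 oner_eq0.
have refl (f : {poly C}) : (size f <= n.+1)%N ->
    (reversed n f).[xi t] = xi t ^+ n * (f.[xi t])^*.
  move=> sf; rewrite horner_reversed //.
  by rewrite (conjC_circle xi1) mul1r invrK.
have sQ := size_opuc (C_posdef Jt) (leqnn n).
rewrite [X in _ = _ + _ * (_ - X)]rmorphM /= fmorphV /=.
apply: (@velocity_identity _ 'i (xi t) _ _ _ _ (b t)^* (xi t ^+ n) _ _
  (P t %/ ('X - (xi t)%:P)).[xi t]) => //.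
- exact: neq0Ci.
- by rewrite conjC_eq0.
- by rewrite -expr2 sqrCi.
- move: Pxi; rewrite rootE horner_paraorth subr_eq0 => /eqP ->.
  by rewrite refl // sQ.
- rewrite (hweight_opuc (moment_herm c0_real Jt) (C_posdef Jt) (b_circle Jt) Pxi).
  by rewrite sqnorm_ip ?sQ.
- rewrite -(cderive_expi J_open xiA Jt).
  rewrite (cderive_branch J_open c_C1 c0_real C_posdef b_C1 b_circle xiB Jt).
  congr (- _); rewrite /paraorth_dot hornerD hornerN hornerM hornerX hornerD.
  rewrite !(hornerZ _ (reversed _ _)).
  rewrite !refl ?sQ //; last exact: leqW (size_opuc_dot _ _ _).
  rewrite (cderive_expi J_open bA Jt) !rmorphM /= conjCi.
  have -> : ((derive1 beta t)%:C%C)^* = (derive1 beta t)%:C%C :> C.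
    by apply: ReIm_eq; rewrite ?complex_Re_conj ?complex_Im_conj //= oppr0.
  by rewrite !mulNr !mulrA.
Qed.

(** By [ip_eval] the left-hand side is xi conj(P_t(xi)) <1, g>, and P_t(xi) is
    - g(xi) xi' along the branch. *)
Lemma ip_paraorth_dot (theta : R -> R) (xi : R -> C) t :
  zero_branch n c b J xi -> C1_argument J xi theta -> J t ->
  xi t * ip n (moments c t) (paraorth_dot n c b t) (P t %/ ('X - (xi t)%:P)) =
  'i * (hweight n (moments c t) (b t) (xi t) * (derive1 theta t)%:C%C).
Proof.
move=> xiB xiA Jt; have [xi1 Pxi] := xiB.2 t Jt.
have mh : herm n (moments c t) := moment_herm c0_real Jt.
have pd := C_posdef Jt; have b1 := b_circle Jt.
rewrite (ip_eval mh pd b1 Pxi); last exact: size_paraorth_dot.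
rewrite (hweight_eval mh pd b1 Pxi).
have -> : ((paraorth_dot n c b t).[xi t])^* =
    - (cderive xi t * (P t %/ ('X - (xi t)%:P)).[xi t])^*.
  rewrite (cderive_branch J_open c_C1 c0_real C_posdef b_C1 b_circle xiB Jt).
  by rewrite rmorphN opprK.
rewrite (cderive_expi J_open xiA Jt) !rmorphM /= conjCi (conjC_circle xi1).
have -> : ((derive1 theta t)%:C%C)^* = (derive1 theta t)%:C%C :> C.
  by apply: ReIm_eq; rewrite ?complex_Re_conj ?complex_Im_conj //= oppr0.
by field; rewrite -normr_eq0 xi1 oner_eq0.
Qed.

Section TwoZeros.
Variables (t : R) (z1 z2 : C).
Hypothesis Jt : J t.
Hypothesis P1 : root (P t) z1.
Hypothesis P2 : root (P t) z2.
Hypothesis z12 : z1 != z2.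
Local Notation G := (P t %/ (('X - z1%:P) * ('X - z2%:P))).

Lemma paraorth_two_roots : P t = ('X - z1%:P) * ('X - z2%:P) * G.
Proof.
rewrite mulrC divpK // Gauss_dvdp ?dvdp_XsubCl ?P1 ?P2 //.
by rewrite coprimep_XsubC root_XsubC eq_sym.
Qed.

Lemma size_two_roots : size G = n.
Proof.
rewrite size_divp ?mulf_neq0 ?polyXsubC_eq0 // size_mul ?polyXsubC_eq0 //.
by rewrite !size_XsubC (size_paraorth (C_posdef Jt)) /= !subSS subn0.
Qed.

(** Partial fractions for z / ((z - z1)(z - z2)), multiplied by P. *)
Lemma quotient_two_roots :
  (z1 - z2) *: ('X * G) =
  z1 *: (P t %/ ('X - z1%:P)) - z2 *: (P t %/ ('X - z2%:P)).
Proof.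
have -> : P t %/ ('X - z1%:P) = ('X - z2%:P) * G.
  by rewrite {1}paraorth_two_roots -mulrA mulrC mulpK ?polyXsubC_eq0.
have -> : P t %/ ('X - z2%:P) = ('X - z1%:P) * G.
  by rewrite {1}paraorth_two_roots mulrAC mulpK ?polyXsubC_eq0.
by rewrite -!mul_polyC polyCB; ring.
Qed.

Lemma BfunE z : Bfun n (moments c t) (b t) z1 z2 z =
  'i * (z1 - z2) * (('X * G).[z] * ((P t).[z])^*).
Proof. by rewrite /Bfun hornerM hornerX; ring. Qed.

Lemma Bfun_real : real_on_circle (Bfun n (moments c t) (b t) z1 z2).
Proof.
have mh : herm n (moments c t) := moment_herm c0_real Jt.
have pd := C_posdef Jt; have b1 := b_circle Jt.
have c1 := paraorth_root_circle mh pd b1 P1.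
have c2 := paraorth_root_circle mh pd b1 P2.
move=> z zC; rewrite CrealE BfunE; apply/eqP.
have -> : (P t).[z] = (z - z1) * (z - z2) * G.[z].
  by rewrite [X in X.[z]]paraorth_two_roots !hornerM !hornerXsubC.
rewrite hornerM hornerX; move: (G.[z]) => g; rewrite !rmorphM !rmorphB /= !conjCK conjCi.
rewrite (conjC_circle zC) (conjC_circle c1) (conjC_circle c2).
have n0 (x : C) : `|x| = 1 -> x != 0 by move=> x1; rewrite -normr_eq0 x1 oner_eq0.
by field; rewrite !n0.
Qed.

Lemma Bfun_Ldot :
  in_Lambda n (Bfun n (moments c t) (b t) z1 z2) /\
  Ldot n c t (Bfun n (moments c t) (b t) z1 z2) =
    - 'i * (z1 * ip n (moments c t) (paraorth_dot n c b t) (P t %/ ('X - z1%:P)) -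
            z2 * ip n (moments c t) (paraorth_dot n c b t) (P t %/ ('X - z2%:P))).
Proof.
have [BL BE] :=
  Ldot_paraorth J_open c_C1 c0_real C_posdef b_C1 Jt (eq_leq size_two_roots).
have [uBL uBE] := functional_lin ('i * (z1 - z2)) 0 BL BL.
have BB z : 'i * (z1 - z2) * (('X * G).[z] * ((P t).[z])^*) +
    0 * (('X * G).[z] * ((P t).[z])^*) = Bfun n (moments c t) (b t) z1 z2 z.
  by rewrite BfunE mul0r addr0.
split; first by apply: in_Lambda_eq uBL => z _; exact: BB.
have -> : Ldot n c t (Bfun n (moments c t) (b t) z1 z2) =
    functional n (fun j => cderive (moment c j) t)
      (fun z => 'i * (z1 - z2) * (('X * G).[z] * ((P t).[z])^*) +
                0 * (('X * G).[z] * ((P t).[z])^*)).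
  by apply: functional_eq => z _; rewrite BB.
rewrite uBE -[functional _ _ _]/(Ldot _ _ _ _) BE mul0r addr0.
set pd := paraorth_dot _ _ _ _; rewrite -[z1 * _]ipZr -[z2 * _]ipZr -ipBr.
by rewrite -quotient_two_roots ipZr; ring.
Qed.

End TwoZeros.

(** Where the two branches meet, B vanishes, and so does the left-hand side,
    since [ip_paraorth_dot] expresses h_xi theta_xi' through the value of the
    zero alone. *)
Lemma two_branches_formula (phi psi : R -> R) (zeta eta : R -> C) t :
  zero_branch n c b J zeta -> C1_argument J zeta phi ->
  zero_branch n c b J eta -> C1_argument J eta psi -> J t ->
  let B := Bfun n (moments c t) (b t) (zeta t) (eta t) in
  [/\ in_Lambda n B, real_on_circle B
    & hweight n (moments c t) (b t) (zeta t) * (derive1 phi t)%:C%C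
      - hweight n (moments c t) (b t) (eta t) * (derive1 psi t)%:C%C
      = Ldot n c t B].
Proof.
move=> zB zA eB eA Jt B; have [_ Pz] := zB.2 t Jt; have [_ Pe] := eB.2 t Jt.
have hz := ip_paraorth_dot zB zA Jt; have he := ip_paraorth_dot eB eA Jt.
have [ze|ze] := eqVneq (zeta t) (eta t); last first.
  have [BL ->] := Bfun_Ldot Jt Pz Pe ze.
  split; [exact: BL|exact: Bfun_real|].
  have iN (x y : C) : - 'i * ('i * x - 'i * y) = x - y.
    by rewrite -mulrBr mulrA mulNr mulCii opprK mul1r.
  by rewrite hz he iN.
have B0 z : B z = 0 by rewrite /B /Bfun ze subrr mulr0 !mul0r.
have [L0 L0E] : in_Lambda n B /\ forall a, functional n a B = 0.
  have [||BL BE] := @laurent_of_sum _ n void (fun=> 0) (fun=> 0) B.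
  - by case.
  - by move=> z _; rewrite B0 big1 // => -[].
  - by split=> // a; rewrite BE big1 // => -[].
split=> //; first by move=> z _; rewrite B0 real0.
rewrite /Ldot L0E; apply: (mulfI (neq0Ci C)).
by rewrite mulrBr -hz -he ze subrr mulr0.
Qed.

End FlowFormulas.

(** * The differentiated functional in coordinates *)

Section ExplicitDerivative.
Context {R : realType}.
Local Notation C := R[i].
Variables (n : nat) (J : set R) (c : nat -> R -> C).
Hypothesis J_open : open J.
Hypothesis c_C1 : forall j, (j <= n)%N -> C1C_on J (c j).
Hypothesis c0_real : forall t, J t -> c 0%N t \is Num.real.

Lemma sum_symmetric (V : nmodType) (h : int -> V) m :
  \sum_(k < (2 * m).+1) h (k%:Z - m%:Z) =
  h 0 + \sum_(1 <= j < m.+1) (h j%:Z + h (- j%:Z)).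
Proof.
elim: m h => [|m IH] h; first by rewrite big_ord_recl big_ord0 big_geq.
have -> : (2 * m.+1)%N = (2 * m).+2 by lia.
rewrite big_ord_recl big_ord_recr /= big_nat_recr //= [in RHS]addrA -IH.
rewrite addrA [X in X + _]addrC -[in LHS]addrA; congr (_ + _).
  apply: eq_bigr => k _; congr h; rewrite /bump /=; lia.
by rewrite addrC; congr (h _ + h _); rewrite /bump /=; lia.
Qed.

(** Conjugation on the circle reverses the coefficients, which are unique. *)
Lemma laurent_real_coef (f : int -> C) : real_on_circle (laurent n f) ->
  forall j, (`|j| <= n)%N -> f (- j) = (f j)^*.
Proof.
move=> fR j jn.
have uniq := @laurent_coef_uniq R n f (fun j => (f (- j))^*) _.
have -> : - j = (absz (- j + n%:Z)%R)%:Z - n%:Z by lia.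
rewrite uniq; [by congr ((f _)^*); lia| |by lia].
by move=> z z1; rewrite -laurent_conj // conj_Creal // fR.
Qed.

Lemma Ldot_laurent (f : int -> C) t : real_on_circle (laurent n f) -> J t ->
  Ldot n c t (laurent n f) =
  f 0 * cderive (c 0%N) t +
    2 * 'Re (\sum_(1 <= j < n.+1) (f j%:Z)^* * cderive (c j) t).
Proof.
move=> fR Jt; have fL : laurent_coef_of n (laurent n f) f by [].
rewrite /Ldot (functional_laurent _ fL).
rewrite (sum_symmetric (fun j => f j * cderive (moment c (- j)) t)) oppr0.
congr (_ + _).
have -> (x : C) : 2 * 'Re x = x + x^* by rewrite ReE; field.
rewrite rmorph_sum -big_split; apply: eq_big_nat => j /andP[j0 jn].
have mh := cderive_moment_herm J_open c_C1 c0_real Jt.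
rewrite opprK addrC (laurent_real_coef fR); last by lia.
by rewrite [cderive (moment c (- _)) t](mh j) // rmorphM /= conjCK.
Qed.

Lemma cderive_const (f : R -> C) t : J t -> (forall s, J s -> f s = f t) ->
  cderive f t = 0.
Proof.
move=> Jt fc; apply: is_cderiveE; apply: is_cderive_near (is_cderive_cst (f t) t).
by apply: (open_near J_open Jt) => s Js; rewrite fc.
Qed.

Lemma Ldot_laurent_single k (f : int -> C) t : (k <= n)%N ->
  (forall j, (j <= n)%N -> j != k -> forall s t, J s -> J t -> c j s = c j t) ->
  real_on_circle (laurent n f) -> J t ->
  Ldot n c t (laurent n f) =
  (2 - (k == 0%N)%:R) * 'Re ((f k%:Z)^* * cderive (c k) t).
Proof.
move=> kn cc fR Jt; rewrite Ldot_laurent //.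
have c0 j : (j <= n)%N -> j != k -> cderive (c j) t = 0.
  by move=> jn jk; apply: cderive_const => // s Js; exact: cc.
have [k0|k0] := eqVneq k 0%N.
  rewrite big_nat big1 => [|j /andP[j0 jn]]; last first.
    by rewrite c0 ?mulr0 //; lia.
  rewrite raddf0 mulr0 addr0 k0 -[2]/(1 + 1) addrK mul1r.
  have mh := cderive_moment_herm J_open c_C1 c0_real Jt.
  have f0 := laurent_real_coef fR (leq0n n : (`|0%:Z| <= n)%N).
  have d0 := mh 0 (leq0n n : (`|0%:Z| <= n)%N).
  rewrite oppr0 in f0 d0; rewrite -f0.
  by rewrite (Creal_ReP _ _) // CrealE rmorphM /= -f0
    -[cderive (c 0%N) t]/(cderive (moment c 0) t) -d0.
rewrite subr0 (c0 0%N) // 1?eq_sym // mulr0 add0r; congr (2 * 'Re _).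
rewrite (bigD1_seq k) ?iota_uniq ?mem_index_iota ?lt0n ?k0 //=.
rewrite big_nat_cond big1 ?addr0 // => j /andP[/andP[_ jn] jk].
by rewrite c0 ?mulr0.
Qed.

End ExplicitDerivative.

(** * Gluing local sections over an interval *)

Section Gluing.
Context {R : realType} {X : Type}.
Variables (J : set R) (good : (R -> X) -> R -> Prop).
Implicit Types (f g : R -> X) (s t : R) (I : set R).

Lemma open_interval_nbhs t (P : set R) : (\forall s \near t, P s) ->
  exists I : set R, [/\ open I, is_interval I, I t & I `<=` P].
Proof.
move=> /nbhs_ballP[e /= e0 eP]; exists (ball t e); split => //.
- exact: ball_open.
- by rewrite ball_itv; exact: interval_is_interval.
- exact: ballxx.
Qed.

(** Connectedness in the form used below: the complement of S in I is required
    to be open at each point, which spares the relative topology. *)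
Lemma connected_open_closed I (S : set R) : is_interval I -> S `<=` I -> S !=set0 ->
  (forall t, S t -> \forall s \near t, S s) ->
  (forall t, I t -> ~ S t -> \forall s \near t, ~ S s) -> S = I.
Proof.
move=> /connected_intervalP Ic SI S0 Sopen Sclosed; apply: Ic => //.
  exists S; first by rewrite openE => t St; exact: Sopen.
  by apply/seteqP; split=> t; [move=> St; split=> //; exact: SI|case].
exists (closure S); first exact: closed_closure.
apply/seteqP; split=> t; first by move=> St; split; [exact: SI|exact: subset_closure].
move=> [It clS]; apply: contrapT => nSt.
by have [s []] := clS _ (Sclosed t It nSt).
Qed.

Hypothesis J_itv : is_interval J.
Hypothesis good_near : forall f g t, (\forall s \near t, f s = g s) ->
  good f t -> good g t.
Hypothesis good_uniq : forall f g t, J t -> good f t -> good g t -> f t = g t ->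
  \forall s \near t, f s = g s.
Hypothesis good_sep : forall f g t, J t -> good f t -> good g t -> f t <> g t ->
  \forall s \near t, f s <> g s.

Lemma good_agree I f g t0 : open I -> is_interval I -> I `<=` J -> I t0 ->
  f t0 = g t0 -> (forall t, I t -> good f t) -> (forall t, I t -> good g t) ->
  forall t, I t -> f t = g t.
Proof.
move=> Io Ii IJ It0 fg0 fI gI t It.
suff /seteqP[_ /(_ t It)[]] : [set s | I s /\ f s = g s] = I by [].
apply: connected_open_closed => //.
- by move=> s [].
- by exists t0.
- move=> s [Is fgs].
  apply: filterS2 (good_uniq (IJ _ Is) (fI _ Is) (gI _ Is) fgs)
    (open_nbhs_nbhs (conj Io Is)) => u fgu Iu.
  by split.
- move=> s Is nS; have nfg : f s <> g s by move=> e; apply: nS.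
  by apply: filterS (good_sep (IJ _ Is) (fI _ Is) (gI _ Is) nfg) => u nu [].
Qed.

Hypothesis good_cover : forall t, J t -> exists I : set R,
  [/\ open I, is_interval I, I t, I `<=` J
  & forall s f, I s -> good f s -> exists g, g s = f s /\ forall u, I u -> good g u].

(** A continuation argument without suprema: the sections over open intervals
    containing t0 agree where they overlap, so they define a section over the
    union U of these intervals. If t is a limit point of U in J, a local section
    over an interval I around t that agrees with it at a point of U extends it
    to the union of U and I, so t lies in U. Thus U is open and closed in J. *)
Lemma glue_sections f0 t0 : J t0 -> good f0 t0 ->
  exists f, f t0 = f0 t0 /\ forall t, J t -> good f t.
Proof.
move=> Jt0 gf0.
pose fam I f := [/\ open I, is_interval I, I `<=` J, I t0 & f t0 = f0 t0 /\
  forall t, I t -> good f t].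
pose U := [set t | exists I f, fam I f /\ I t].
have [xi xiP] : exists xi : R -> X, forall I f, fam I f -> forall t, I t -> xi t = f t.
  have /choice[xi xiP] : forall t, exists x, forall I f, fam I f -> I t -> x = f t.
    move=> t; have [[I [f [fI It]]]|nU] := pselect (U t); last first.
      by exists (f0 t0) => I f fI It; case: nU; exists I, f.
    exists (f t) => I' f' fI' It'.
    case: fI => Io Ii IJ It0 [ft0 fg]; case: fI' => Io' Ii' _ It0' [ft0' fg'].
    apply: (@good_agree (I `&` I') f f' t0) => //.
    - exact: openI.
    - move=> x y [Ix Ix'] [Iy Iy'] z xzy.
      by split; [exact: (Ii _ _ Ix Iy)|exact: (Ii' _ _ Ix' Iy')].
    - by move=> s [/IJ].
    - by rewrite ft0 ft0'.
    - by move=> s [/fg].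
    - by move=> s [_ /fg'].
  by exists xi => I f fI t It; exact: xiP fI It.
have [I0 [I0o I0i I0t0 I0J I0P]] := good_cover Jt0.
have [g0 [g0t0 g0P]] := I0P t0 f0 I0t0 gf0.
have fam0 : fam I0 g0 by [].
have Uopen t : U t -> \forall s \near t, U s.
  move=> [I [f [fI It]]]; have [Io _ _ _ _] := fI.
  by apply: filterS (open_nbhs_nbhs (conj Io It)) => s Is; exists I, f.
have Ut0 : U t0 by exists I0, g0.
have Ugood t : U t -> good xi t.
  move=> [I [f [fI It]]]; have [Io _ _ _ [_ fg]] := fI.
  apply: good_near (fg t It).
  by apply: filterS (open_nbhs_nbhs (conj Io It)) => s Is; rewrite (xiP _ _ fI).
have Ui : is_interval U.
  move=> x y [I [f [fI Ix]]] [I' [f' [fI' Iy]]] z /andP[xz zy].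
  have [zt|tz] := leP z t0.
    exists I, f; split=> //; have [_ Ii _ It0 _] := fI.
    by apply: (Ii _ _ Ix It0); rewrite xz zt.
  exists I', f'; split=> //; have [_ Ii _ It0 _] := fI'.
  by apply: (Ii _ _ It0 Iy); rewrite (ltW tz) zy.
have UJ : U `<=` J by move=> t [I [f [[_ _ IJ _ _] /IJ]]].
suff UE : U = J by exists xi; split; [rewrite (xiP _ _ fam0)|rewrite -UE; exact: Ugood].
apply: connected_open_closed => //; first by exists t0.
move=> t Jt nU; have [I [Io Ii It IJ IP]] := good_cover Jt.
apply: filterS (open_nbhs_nbhs (conj Io It)) => s Is Us; apply: nU.
have [g [gs gP]] := IP s xi Is (Ugood s Us).
pose h u := if pselect (U u) then xi u else g u.
have hU u : U u -> h u = xi u by rewrite /h; case: pselect.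
have hI u : I u -> h u = g u.
  move=> Iu; rewrite /h; case: pselect => // Uu.
  apply: (@good_agree (U `&` I) xi g s) => //.
  - by apply: openI => //; rewrite openE => v; exact: Uopen.
  - move=> x y [Ux Ix] [Uy Iy] z xzy.
    by split; [exact: (Ui _ _ Ux Uy)|exact: (Ii _ _ Ix Iy)].
  - by move=> v [/UJ].
  - by move=> v [/Ugood].
  - by move=> v [_ /gP].
exists (U `|` I), h; split; last by right.
split.
- by apply: openU => //; rewrite openE => v; exact: Uopen.
- move=> x y Hx Hy z /andP[xz zy].
  have [zs|sz] := leP z s.
    by case: Hx => Hx; [left; apply: (Ui _ _ Hx Us)|right; apply: (Ii _ _ Hx Is)];
       rewrite xz zs.
  by case: Hy => Hy; [left; apply: (Ui _ _ Us Hy)|right; apply: (Ii _ _ Is Hy)];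
     rewrite zy ltW.
- by move=> v [/UJ|/IJ].
- by left.
- split; first by rewrite hU // (xiP _ _ fam0).
  move=> v [Uv|Iv].
    by apply: good_near (Ugood v Uv); apply: filterS (Uopen v Uv) => w Uw; rewrite hU.
  apply: good_near (gP v Iv).
  by apply: filterS (open_nbhs_nbhs (conj Io Iv)) => w Iw; rewrite hI.
Qed.

End Gluing.

(** * Continuity of the roots of a polynomial *)

Section RootContinuity.
Context {R : realType}.
Local Notation C := R[i].
Implicit Types (p : {poly C}) (z w : C) (e : R).

(** The value p(z) is the product of the distances from z to the roots, so they
    cannot all be at least e. *)
Lemma monic_root_near p z e : p \is monic -> 0 < e ->
  `|p.[z]| < e%:C%C ^+ (size p).-1 -> exists2 w, root p w & `|w - z| < e%:C%C.
Proof.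
move=> pm e0; have [r rE] := closed_field_poly_normal p.
have pE : p = \prod_(w <- r) ('X - w%:P) by rewrite rE (eqP pm) scale1r.
have -> : (size p).-1 = size r by rewrite pE size_prod_XsubC.
have [/hasP[w wr wz] _|/hasPn nh] := boolP (has (fun w => `|w - z| < e%:C%C) r).
  by exists w => //; rewrite pE root_prod_XsubC.
have eC : 0 <= e%:C%C :> C by rewrite lecR ltW.
suff pz : e%:C%C ^+ size r <= `|p.[z]|.
  by move=> /(le_lt_trans pz); rewrite ltxx.
rewrite pE; elim: r nh {rE pE} => [|w r IH] nh.
  by rewrite big_nil expr0 hornerC normr1.
rewrite big_cons hornerM hornerXsubC normrM exprS ler_pM ?exprn_ge0 //.
  by rewrite distrC real_leNgt ?normr_real ?ger0_real // nh ?mem_head.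
by apply: IH => v vr; rewrite nh // inE vr orbT.
Qed.

Lemma positive_lower_bound (T : eqType) (s : seq T) (F : T -> R) :
  (forall x, x \in s -> 0 < F x) -> exists2 e, 0 < e & forall x, x \in s -> e <= F x.
Proof.
elim: s => [|x s IH] Fs; first by exists 1.
have [|e e0 es] := IH; first by move=> y ys; apply: Fs; rewrite inE ys orbT.
exists (Order.min e (F x)); first by rewrite lt_min e0 Fs ?mem_head.
by move=> y; rewrite inE => /predU1P[->|/es ey]; rewrite ge_min ?lexx ?orbT ?ey.
Qed.

Lemma monic_simple_roots p : p \is monic ->
  (forall z, root p z -> (p %/ ('X - z%:P)).[z] != 0) ->
  exists r : seq C, [/\ uniq r, size p = (size r).+1 & root p =1 [in r]].
Proof.
move=> pm ps; have [r rE] := closed_field_poly_normal p.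
have pE : p = \prod_(z <- r) ('X - z%:P) by rewrite rE (eqP pm) scale1r.
exists r; split; last by move=> z; rewrite pE root_prod_XsubC.
  apply: count_mem_uniq => z; have [zr|/count_memPn //] := boolP (z \in r).
  have pz : root p z by rewrite pE root_prod_XsubC.
  have := ps z pz; rewrite pE (perm_big _ (perm_to_rem zr)) big_cons /=.
  rewrite mulrC mulpK ?polyXsubC_eq0 //.
  rewrite -rootE root_prod_XsubC => zrem.
  by rewrite (permP (perm_to_rem zr)) /= eqxx (count_memPn zrem).
by rewrite pE size_prod_XsubC.
Qed.

(** Choosing for each x in rs a close element of rt is injective by separation,
    hence onto: each element of rt is close to some x, and each x is close to
    exactly one element of rt. *)
Lemma pigeonhole_close_roots (rs rt : seq C) (e : C) :
  uniq rs -> uniq rt -> size rs = size rt ->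
  (forall x y, x \in rs -> y \in rs -> x != y -> e + e <= `|x - y|) ->
  (forall x, x \in rs -> exists2 w, w \in rt & `|w - x| < e) ->
  (forall w, w \in rt -> exists2 x, x \in rs & `|w - x| < e) /\
  (forall x w w', x \in rs -> w \in rt -> w' \in rt -> `|w - x| < e ->
     `|w' - x| < e -> w = w').
Proof.
move=> us ut st sep ex.
pose phi x := head 0 [seq w <- rt | `|w - x| < e].
have hd (l : seq C) v : v \in l -> head 0 l \in l.
  by case: l => //= u l _; rewrite mem_head.
have phiP x : x \in rs -> phi x \in rt /\ `|phi x - x| < e.
  move=> /ex[w wt wx].
  have wf : w \in [seq w <- rt | `|w - x| < e] by rewrite mem_filter wx.
  have : phi x \in [seq w <- rt | `|w - x| < e].
    exact: hd wf.
  by rewrite mem_filter => /andP[? ?]; split.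
have close x y w : x \in rs -> y \in rs -> `|w - x| < e -> `|w - y| < e -> x = y.
  move=> xs ys wx wy; apply/eqP; apply: contraTT isT => xy.
  have lt2 : `|x - w| + `|w - y| < e + e by rewrite ltrD // distrC.
  have := le_lt_trans (sep _ _ xs ys xy) (le_lt_trans (ler_distD w x y) lt2).
  by rewrite ltxx.
have um : uniq (map phi rs).
  rewrite map_inj_in_uniq // => x y xs ys xy.
  by apply: (close x y (phi x)) => //; [|rewrite xy]; apply phiP.
have sub : {subset map phi rs <= rt} by move=> _ /mapP[x xs ->]; have [] := phiP x xs.
have [|_ eqm] := uniq_min_size um sub; first by rewrite size_map st.
have onto w : w \in rt -> exists2 x, x \in rs & w = phi x.
  by rewrite -eqm => /mapP.
split=> [w /onto[x xs ->]|x w w' xs /onto[y ys ->] /onto[y' ys' ->] yx y'x].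
  by exists x => //; have [] := phiP x xs.
have -> : y = x by apply: close yx => //; have [] := phiP y ys.
by have -> : y' = x by apply: close y'x => //; have [] := phiP y' ys'.
Qed.

Lemma norm_le_ReIm z : `|z| <= (`|complex.Re z| + `|complex.Im z|)%:C%C.
Proof.
have -> : `|z| = `|(complex.Re z)%:C%C + 'i%C * (complex.Im z)%:C%C|.
  by congr `|_|; apply: ReIm_eq; case: z => u v /=; ring.
rewrite rmorphD /= (le_trans (ler_normD _ _)) // normrM.
have -> : `|'i%C : C| = 1 by rewrite complexiE normCi.
rewrite mul1r.
have nR (u : R) : `|u%:C%C : C| = `|u|%:C%C.
  by rewrite normc_def /= expr0n addr0 sqrtr_sqr.
by rewrite !nR.
Qed.

Lemma ccontP (f : R -> C) t :
  ccont f t <-> forall e, 0 < e -> \forall s \near t, `|f s - f t| < e%:C%C.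
Proof.
split=> [[fR fI] e e0|H].
  have e2 : 0 < e / 2 by rewrite divr_gt0.
  have /cvgrPdist_lt /(_ _ e2) nR := fR; have /cvgrPdist_lt /(_ _ e2) nI := fI.
  apply: filterS2 nR nI => s sR sI; apply: le_lt_trans (norm_le_ReIm _) _.
  rewrite ltcR [ltRHS]splitr.
  have -> : complex.Re (f s - f t) = ReC f s - ReC f t
    by rewrite /ReC; case: (f s); case: (f t).
  have -> : complex.Im (f s - f t) = ImC f s - ImC f t
    by rewrite /ImC; case: (f s); case: (f t).
  by rewrite ltrD // distrC.
have ReN (x y : C) : complex.Re (x - y) = complex.Re x - complex.Re y by case: x; case: y.
have ImN (x y : C) : complex.Im (x - y) = complex.Im x - complex.Im y by case: x; case: y.
split; apply/cvgrPdist_lt => e e0; apply: filterS (H e e0) => s fs.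
  rewrite distrC -ltcR; apply: le_lt_trans fs.
  by have := normc_ge_Re (f s - f t); rewrite ReN.
rewrite distrC -ltcR; apply: le_lt_trans fs.
(* The imaginary part is, up to sign, the real part of the product by i. *)
have := normc_ge_Re ((f s - f t) * 'i%C).
rewrite normrM [`|'i%C|](_ : _ = 1) ?mulr1; last by rewrite complexiE normCi.
by rewrite complex_ReM /= mulr0 mulr1 sub0r normrN ImN.
Qed.

End RootContinuity.

Section RootBranches.
Context {R : realType}.
Local Notation C := R[i].
Variables (J : set R) (p : R -> {poly C}) (N : nat).
Hypothesis J_open : open J.
Hypothesis J_itv : is_interval J.
Hypothesis p_monic : forall t, J t -> p t \is monic.
Hypothesis p_size : forall t, J t -> size (p t) = N.+1.
Hypothesis p_cont : forall t k, J t -> ccont (fun s => (p s)`_k) t.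
Hypothesis p_simple : forall t z, J t -> root (p t) z -> (p t %/ ('X - z%:P)).[z] != 0.

(** The local property glued below: continuity is asked at t only, the root
    equation in a neighbourhood. *)
Definition root_at (f : R -> C) t := ccont f t /\ \forall s \near t, root (p s) (f s).

Lemma root_at_near f g t : (\forall s \near t, f s = g s) -> root_at f t -> root_at g t.
Proof.
move=> fg [cf rf]; split; first exact: ccont_near fg cf.
by apply: filterS2 fg rf => s ->.
Qed.

(** The divided difference between the two branches tends to the derivative at a
    simple root, so it does not vanish nearby, and only one of two distinct
    points could be a root. *)
Lemma root_at_uniq f g t : J t -> root_at f t -> root_at g t -> f t = g t ->
  \forall s \near t, f s = g s.
Proof.
move=> Jt [cf rf] [cg rg] fgt.
have sp : \forall s \near t, (size (p s) <= N.+1)%N.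
  by apply: (open_near J_open Jt) => s /p_size ->.
have cD := ccont_ddiff N.+1 (fun k => p_cont k Jt) cf cg.
have D0 : (ddiff N.+1 (p t) (f t)).[g t] != 0.
  have rft := nbhs_singleton rf.
  by rewrite -fgt (ddiff_quotient (nbhs_singleton sp) rft) p_simple.
apply: filterS (filterI (filterI sp rf) (filterI rg (ccont_neq0 cD D0))).
move=> s [[sps rfs] [rgs Ds]]; have := ddiff_root (g s) sps rfs.
move: rgs; rewrite rootE => /eqP -> /esym/eqP.
by rewrite mulf_eq0 (negPf Ds) orbF subr_eq0 => /eqP.
Qed.

Lemma root_at_sep f g t : J t -> root_at f t -> root_at g t -> f t <> g t ->
  \forall s \near t, f s <> g s.
Proof.
move=> Jt [cf _] [cg _] fg; have cfg := ccontD cf (ccontN cg).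
have fg0 : f t - g t != 0 by rewrite subr_eq0; apply/eqP.
by apply: filterS (ccont_neq0 cfg fg0) => s /= /[swap] ->; rewrite subrr eqxx.
Qed.

Lemma near_all_seq (T : eqType) (r : seq T) (Q : T -> R -> Prop) (t : R) :
  (forall x, x \in r -> \forall s \near t, Q x s) ->
  \forall s \near t, forall x, x \in r -> Q x s.
Proof.
elim: r => [|x r IH] H; first exact: filterE.
have Hr : \forall s \near t, forall y, y \in r -> Q y s.
  by apply: IH => y yr; apply: (H y); rewrite inE yr orbT.
apply: filterS2 (H x (mem_head _ _)) Hr => s Qx Qr y.
by rewrite inE => /predU1P[->|/Qr].
Unshelve. all: by end_near. Qed.

Lemma root_near_along t z (e : R) : J t -> root (p t) z -> 0 < e ->
  \forall s \near t, exists2 w, root (p s) w & `|w - z| < e%:C%C.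
Proof.
move=> Jt pz e0.
have sp : \forall s \near t, (size (p s) <= N.+1)%N.
  by apply: (open_near J_open Jt) => s /p_size ->.
have cz := ccont_horner sp (fun k => p_cont k Jt) (ccont_cst z t).
have eN : 0 < e ^+ N by rewrite exprn_gt0.
have Js : \forall s \near t, J s by exact: (open_near J_open Jt).
have /ccontP/(_ _ eN) nz := cz.
apply: filterS2 nz Js => s; rewrite (eqP pz) subr0 => psz Jst.
by apply: monic_root_near (p_monic Jst) e0 _; rewrite p_size //= -rmorphXn.
Qed.

(** Near T each root of p(T) has exactly one root of p(s) within half a
    separation distance of the roots of p(T); following it is continuous by
    [root_near_along]. *)
Lemma root_local_sections T : J T -> exists I : set R,
  [/\ open I, is_interval I, I T, I `<=` J
  & forall s x, I s -> root (p s) x ->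
      exists g, g s = x /\ forall u, I u -> root_at g u].
Proof.
move=> JT; have [rs [urs srs rsE]] :=
  monic_simple_roots (p_monic JT) (fun z => p_simple JT (z := z)).
pose nrm (z : C) : R := complex.Re `|z|.
have nrmE z : (nrm z)%:C%C = `|z| by rewrite /nrm normc_def.
have [d d0 dP] : exists2 e, 0 < e &
    forall q, q \in [seq (x, y) | x <- rs, y <- rs] -> q.1 != q.2 -> e <= nrm (q.1 - q.2).
  have [|e e0 eP] := @positive_lower_bound _ _
    [seq q <- [seq (x, y) | x <- rs, y <- rs] | q.1 != q.2] (fun q => nrm (q.1 - q.2)).
    by move=> q; rewrite mem_filter => /andP[q12 _];
       rewrite -ltcR nrmE normr_gt0 subr_eq0.
  by exists e => // q qs q12; apply: eP; rewrite mem_filter q12.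
pose e := d / 2; have e0 : 0 < e by rewrite divr_gt0.
have sep x y : x \in rs -> y \in rs -> x != y -> e%:C%C + e%:C%C <= `|x - y|.
  move=> xs ys xy; rewrite -rmorphD -splitr -nrmE lecR.
  by apply: (dP (x, y)) => //; apply: allpairs_f.
have nearT : \forall s \near T, J s /\
    forall z, z \in rs -> exists2 w, root (p s) w & `|w - z| < e%:C%C.
  have H : \forall s \near T, forall z, z \in rs ->
      exists2 w, root (p s) w & `|w - z| < e%:C%C.
    by apply: near_all_seq => z zr; apply: root_near_along => //; rewrite rsE.
  by apply: filterS2 H (open_near J_open JT (fun _ => id)) => s ? ?; split.
have [I [Io Ii IT IP]] := open_interval_nbhs nearT.
have IJ : I `<=` J by move=> s /IP[].
(* For s in I, the roots of p(s) are in bijection with those of p(T). *)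
have pig s : I s ->
    (forall w, root (p s) w -> exists2 x, x \in rs & `|w - x| < e%:C%C) /\
    (forall x w w', x \in rs -> root (p s) w -> root (p s) w' ->
      `|w - x| < e%:C%C -> `|w' - x| < e%:C%C -> w = w').
  move=> Is; have [Js ex] := IP s Is.
  have [rt [urt srt rtE]] :=
    monic_simple_roots (p_monic Js) (fun z => p_simple Js (z := z)).
  have st : size rs = size rt by apply: succn_inj; rewrite -srs -srt !p_size.
  have [|onto uniq] := pigeonhole_close_roots urs urt st sep.
    by move=> x /ex[w pw wx]; exists w; rewrite -?rtE.
  split=> [w|x w w' xs]; first by rewrite rtE => /onto.
  by rewrite !rtE; exact: uniq.
exists I; split=> // s x Is px.
have [z zr xz] := (pig s Is).1 x px.
have /choice[g gP] : forall u, exists w, I u -> root (p u) w /\ `|w - z| < e%:C%C.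
  move=> u; have [Iu|nI] := pselect (I u); last by exists 0 => /nI.
  by have [w pw wz] := (IP u Iu).2 z zr; exists w.
have gI u : I u -> root (p u) (g u) by move=> /gP[].
have gz u : I u -> `|g u - z| < e%:C%C by move=> /gP[].
exists g; split; first by apply: (pig s Is).2 zr (gI _ Is) px (gz _ Is) xz.
move=> u Iu; have Inear := open_nbhs_nbhs (conj Io Iu).
split; last by apply: filterS Inear => v /gI.
apply/ccontP => e1 e10.
pose r := Order.min e1 (e - nrm (g u - z)).
have r0 : 0 < r by rewrite lt_min e10 subr_gt0 -ltcR nrmE gz.
apply: filterS2 (root_near_along (IJ _ Iu) (gI _ Iu) r0) Inear => v [w pw wg] Iv.
suff <- : w = g v by apply: lt_le_trans wg _; rewrite lecR ge_min lexx.
apply: (pig v Iv).2 zr pw (gI _ Iv) _ (gz _ Iv).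
have -> : w - z = (w - g u) + (g u - z) by rewrite addrA subrK.
apply: le_lt_trans (ler_normD _ _) _; rewrite -ltrBrDr -nrmE -rmorphB.
by apply: lt_le_trans wg _; rewrite lecR ge_min lexx orbT.
Qed.

Lemma continuous_root_branch t0 z0 : J t0 -> root (p t0) z0 ->
  exists f, f t0 = z0 /\ forall t, J t -> ccont f t /\ root (p t) (f t).
Proof.
move=> Jt0 pz0; have [I0 [_ _ I0t0 _ /(_ t0 z0 I0t0 pz0)[f0 [f0t0 f0P]]]] :=
  root_local_sections Jt0.
have cover t : J t -> exists I : set R, [/\ open I, is_interval I, I t, I `<=` J
    & forall s f, I s -> root_at f s ->
        exists g, g s = f s /\ forall u, I u -> root_at g u].
  move=> Jt; have [I [Io Ii It IJ IP]] := root_local_sections Jt.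
  by exists I; split=> // s f Is [_ /nbhs_singleton]; exact: IP.
have [f [ft0 fP]] :=
  glue_sections J_itv root_at_near root_at_uniq root_at_sep cover Jt0 (f0P t0 I0t0).
exists f; split=> [|t Jt]; first by rewrite ft0.
by have [cf /nbhs_singleton] := fP t Jt.
Qed.

End RootBranches.

(** * Arguments of curves on the circle *)

Section Arguments.
Context {R : realType}.
Local Notation C := R[i].
Implicit Types (x y : R) (z : C) (f : R -> C) (th : R -> R).

Lemma expiD x y : expi (x + y) = expi x * expi y.
Proof.
rewrite /expi cosD sinD; apply: ReIm_eq => //=.
by rewrite addrC mulrC [X in _ + X]mulrC addrC.
Qed.

Lemma expi_conj x : (expi x)^* = expi (- x).
Proof. by rewrite /expi cosN sinN. Qed.

Lemma ReIm_circle z : `|z| = 1 -> complex.Re z ^+ 2 + complex.Im z ^+ 2 = 1.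
Proof.
rewrite normc_def => /(congr1 (@complex.Re R)) /= h.
by rewrite -[LHS]sqr_sqrtr ?addr_ge0 ?sqr_ge0 // h expr1n.
Qed.

(** The arcsine of the imaginary part is an argument on the right half of the
    circle. *)
Lemma expi_asin z : `|z| = 1 -> 0 < complex.Re z ->
  -1 < complex.Im z < 1 /\ expi (asin (complex.Im z)) = z.
Proof.
move=> /ReIm_circle z1 z0.
have im1 : complex.Im z ^+ 2 < 1 by rewrite -z1 ltrDr exprn_gt0.
have imB : -1 < complex.Im z < 1.
  by rewrite -ltr_norml -(@ltr_pXn2r _ 2) ?nnegrE // expr1n -normrX ger0_norm ?sqr_ge0.
have imB' : -1 <= complex.Im z <= 1 by case/andP: imB => ? ?; rewrite !ltW.
split=> //; rewrite /expi cos_asin // asinK ?in_itv //=.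
rewrite -z1 addrK sqrtr_sqr gtr0_norm //.
by apply: ReIm_eq.
Qed.

Lemma expi_onto z : `|z| = 1 -> exists x, z = expi x.
Proof.
move=> /ReIm_circle z1.
have reB : -1 <= complex.Re z <= 1.
  rewrite -ler_norml -(@ler_pXn2r _ 2) ?nnegrE // expr1n -normrX.
  by rewrite ger0_norm ?sqr_ge0 // -z1 lerDl sqr_ge0.
have sE : Num.sqrt (1 - complex.Re z ^+ 2) = `|complex.Im z|.
  by rewrite -z1 [X in X - _]addrC addrK sqrtr_sqr.
have [i0|i0] := lerP 0 (complex.Im z).
  exists (acos (complex.Re z)); apply: ReIm_eq; rewrite /= ?acosK ?in_itv //.
  by rewrite sin_acos // sE ger0_norm.
exists (- acos (complex.Re z)); apply: ReIm_eq; rewrite /= ?cosN ?acosK ?in_itv //.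
by rewrite sinN sin_acos // sE ltr0_norm // opprK.
Qed.

Definition argument_at f th t :=
  {for t, continuous th} /\ \forall s \near t, f s = expi (th s).

Lemma asin_sin_small x : `|x| < pi / 2 -> asin (sin x) = x.
Proof.
by rewrite ltr_norml => /andP[x1 x2]; rewrite sinK // in_itv /= !ltW.
Qed.

Lemma asin_0 : asin 0 = 0 :> R.
Proof. by rewrite -{1}sin0 asin_sin_small // normr0 divr_gt0 // pi_gt0. Qed.

Lemma near_small (th : R -> R) t : {for t, continuous th} ->
  \forall s \near t, `|th s - th t| < pi / 2.
Proof.
move=> cth; have p0 : 0 < pi / 2 :> R by rewrite divr_gt0 // pi_gt0.
have /cvgrPdist_lt/(_ _ p0) := cth.
by apply: filterS => s; rewrite distrC.
Qed.

Lemma argument_at_near f th th' t : (\forall s \near t, th s = th' s) ->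
  argument_at f th t -> argument_at f th' t.
Proof.
move=> e [cth fth]; split; first exact: cont_near e cth.
by apply: filterS2 e fth => s ->.
Qed.

Lemma argument_at_sep f th th' t : argument_at f th t -> argument_at f th' t ->
  th t <> th' t -> \forall s \near t, th s <> th' s.
Proof.
move=> [cth _] [cth' _] ne; have n0 : th t - th' t != 0 by rewrite subr_eq0; apply/eqP.
have cd : (fun s => th s - th' s) @ t --> th t - th' t by apply: cvgB.
have H : \forall s \near t, th s - th' s != 0 by exact: cvgr_neq0 cd n0.
by apply: filterS H => s /= /[swap] ->; rewrite subrr eqxx.
Qed.

Lemma expi_sub x y : expi (x - y) = expi x * (expi y)^*.
Proof. by rewrite expiD expi_conj. Qed.

Lemma sin_Im x : sin x = complex.Im (expi x). Proof. by []. Qed.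

(** A continuous argument is determined near t by its value there, and it is a
    smooth function of f: this gives local uniqueness, and later the class
    C^1. *)
Lemma argument_at_asin f th t : argument_at f th t ->
  \forall s \near t, th s = th t + asin (complex.Im (f s * (f t)^*)).
Proof.
move=> [cth fth]; have ft := nbhs_singleton fth.
apply: filterS2 fth (near_small cth) => s fs small.
by rewrite fs ft -expi_sub -sin_Im asin_sin_small // addrC subrK.
Qed.

Lemma argument_at_uniq f th th' t : argument_at f th t -> argument_at f th' t ->
  th t = th' t -> \forall s \near t, th s = th' s.
Proof.
move=> a a' e; apply: filterS2 (argument_at_asin a) (argument_at_asin a') => s -> ->.
by rewrite e.
Qed.

(** By [argument_at_asin] the derivative is the imaginary part of
    f'(t) conj(f(t)), because the arcsine has slope 1 at 0. *)
Lemma C1_argument_at (J : set R) f th : open J -> C1C_on J f ->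
  (forall t, J t -> argument_at f th t) -> C1_argument J f th.
Proof.
move=> Jo fC thA; split; last by move=> t /thA[_ /nbhs_singleton].
apply: (@C1_onP _ _ Jo _ (fun t => complex.Im (cderive f t * (f t)^*))) => t Jt.
split; last first.
  by have [] := ccontM (C1C_ccont_cderive fC Jt) (ccont_conj (C1C_ccont fC Jt)).
have dv : is_derive t 1 (ImC (fun s => f s * (f t)^*))
    (complex.Im (cderive f t * (f t)^*)).
  have [_] := is_cderiveM (C1C_cderive fC Jt) (is_cderive_cst (f t)^* t).
  by rewrite mulr0 addr0.
have v0 : ImC (fun s => f s * (f t)^*) t = 0.
  by rewrite /ImC complex_ImM complex_Re_conj complex_Im_conj; ring.
have da : is_derive (ImC (fun s => f s * (f t)^*) t) 1 asin (1 : R).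
  rewrite v0; apply: (is_derive_eq (is_derive1_asin _)); rewrite ?ltrN10 ?ltr01 //.
  by rewrite expr0n subr0 sqrtr1 invr1.
have := is_deriveD (is_derive_cst (th t) t 1) (is_derive1_comp da dv).
rewrite add0r mul1r; apply: near_eq_is_derive.
by apply: filterS (argument_at_asin (thA t Jt)) => s ->.
Qed.

(** Around T, where f stays within distance 1/2 of f(T), all quotients f(u) / f(s)
    lie in the right half plane, so [expi_asin] provides local sections through
    every given argument of f(s). *)
Lemma C1_argument_exists (J : set R) f : open J -> is_interval J -> C1C_on J f ->
  (forall t, J t -> `|f t| = 1) -> exists th, C1_argument J f th.
Proof.
move=> Jo Ji fC f1.
have local T : J T -> exists I : set R, [/\ open I, is_interval I, I T, I `<=` J
  & forall s x, I s -> f s = expi x ->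
      exists g, g s = x /\ forall u, I u -> argument_at f g u].
  move=> JT; have h0 : (0 : R) < 1 / 2 by rewrite divr_gt0.
  have /ccontP/(_ _ h0) fT := C1C_ccont fC JT.
  have JnT := open_near Jo JT (fun _ => id).
  have [I [Io Ii IT IP]] := open_interval_nbhs (filterI JnT fT).
  exists I; split=> // [s /IP[]//|s x Is fs].
  have Re0 u : I u -> 0 < complex.Re (f u * (f s)^*).
    move=> Iu; have [Ju uT] := IP u Iu; have [Js sT] := IP s Is.
    have : `|f u * (f s)^* - 1| < 1.
      have -> : f u * (f s)^* - 1 = (f u - f s) * (f s)^*.
        by rewrite mulrBl -normCK f1 // expr1n.
      rewrite normrM norm_conjC f1 // mulr1.
      have := le_lt_trans (ler_distD (f T) (f u) (f s)) (ltrD uT _).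
      rewrite distrC in sT; move=> /(_ _ sT); rewrite -rmorphD -splitr.
      by [].
    move=> /(le_lt_trans (normc_ge_Re _)); rewrite ltcR ltr_norml => /andP[+ _].
    by rewrite complex_ReD /= ltrBrDr addrC subrr.
  have unit u : I u -> `|f u * (f s)^*| = 1.
    move=> Iu; have [Ju _] := IP u Iu; have [Js _] := IP s Is.
    by rewrite normrM norm_conjC !f1 ?mulr1.
  exists (fun u => x + asin (complex.Im (f u * (f s)^*))); split.
    by rewrite -normCK f1 ?expr1n /= ?asin_0 ?addr0 //; have [] := IP s Is.
  move=> u Iu; split.
    have [_ ci] := ccontM (C1C_ccont fC (IP u Iu).1) (ccont_cst (f s)^* u).
    have [imB _] := expi_asin (unit u Iu) (Re0 u Iu).
    apply: cvgD; first exact: cvg_cst.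
    apply: (@continuous_comp _ _ _ (ImC (fun u => f u * (f s)^*)) asin) => //.
    exact: continuous_asin.
  apply: filterS (open_nbhs_nbhs (conj Io Iu)) => v Iv.
  have [_ e] := expi_asin (unit v Iv) (Re0 v Iv).
  rewrite expiD e -fs mulrCA -normCK f1 ?expr1n ?mulr1 //.
  by have [] := IP s Is.
have [J0|/set0P[t0 Jt0]] := eqVneq J set0.
  by exists (fun=> 0); split=> t; rewrite J0.
have [x0 fx0] := expi_onto (f1 t0 Jt0).
have [I0 [_ _ I0t0 _ /(_ t0 x0 I0t0 fx0)[f0 [f0t0 f0P]]]] := local t0 Jt0.
have cover t : J t -> exists I : set R, [/\ open I, is_interval I, I t, I `<=` J
    & forall s th, I s -> argument_at f th s ->
      exists g, g s = th s /\ forall u, I u -> argument_at f g u].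
  move=> Jt; have [I [Io Ii It IJ IP]] := local t Jt.
  by exists I; split=> // s th Is [_ /nbhs_singleton]; exact: IP.
have [th [_ thP]] := glue_sections Ji (@argument_at_near f)
  (fun th th' t _ => @argument_at_uniq f th th' t)
  (fun th th' t _ => @argument_at_sep f th th' t) cover Jt0 (f0P t0 I0t0).
by exists th; apply: C1_argument_at.
Qed.

End Arguments.

(** * Existence and regularity of the zero branches *)

Section ZeroBranches.
Context {R : realType}.
Local Notation C := R[i].
Variables (n : nat) (J : set R) (c : nat -> R -> C) (b : R -> C).
Hypothesis J_open : open J.
Hypothesis J_itv : is_interval J.
Hypothesis c_C1 : forall j, (j <= n)%N -> C1C_on J (c j).
Hypothesis c0_real : forall t, J t -> c 0%N t \is Num.real.
Hypothesis C_posdef : forall t, J t -> posdefmx (toeplitz (moments c t) n.+1).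
Hypothesis b_C1 : C1C_on J b.
Hypothesis b_circle : forall t, J t -> `|b t| = 1.
Local Notation P t := (paraorth n (moments c t) (b t)).

Lemma paraorth_C1 : C1poly J (fun t => P t).
Proof.
have CQ := opuc_C1 J_open c_C1 C_posdef (leqnn n).
have Crev k : C1C_on J (fun t => (reversed n (opuc (moments c t) n))`_k).
  case: (ltnP k n.+1) => kn; last first.
    by apply: C1C_eq (C1C_cst J_open 0) => // t _; rewrite coef_poly ltnNge kn.
  by apply: C1C_eq (C1C_conj J_open (CQ (n - k)%N)) => // t _; rewrite coef_poly kn.
move=> k; have CX := C1polyM J_open (C1poly_cst J_open 'X) CQ k.
have Cb := C1C_M J_open (C1C_cst J_open (- 1))
  (C1C_M J_open (C1C_conj J_open b_C1) (Crev k)).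
apply: C1C_eq (C1C_D J_open CX Cb) => // t _.
by rewrite /paraorth coefB [in RHS]coefZ mulN1r.
Qed.

(** The formula - P_t(xi) / g(xi) for the derivative, with g(xi) expressed as a
    divided difference, is continuous along a continuous branch. *)
Lemma continuous_branch_C1 xi : (forall t, J t -> ccont xi t /\ root (P t) (xi t)) ->
  zero_branch n c b J xi.
Proof.
move=> xiP; split; last first.
  move=> t Jt; have [_ Pxi] := xiP t Jt; split=> //.
  exact: (paraorth_root_circle (moment_herm c0_real Jt) (C_posdef Jt) (b_circle Jt) Pxi).
have sP t : J t -> (size (P t) <= n.+2)%N.
  by move=> Jt; rewrite (size_paraorth (C_posdef Jt)).
have CP := paraorth_C1.
have cP t k : J t -> ccont (fun s => (P s)`_k) t by exact: (C1C_ccont (CP k)).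
pose D t := (ddiff n.+2 (P t) (xi t)).[xi t].
have D0 t : J t -> D t != 0.
  move=> Jt; have [_ Pxi] := xiP t Jt; rewrite /D ddiff_quotient ?sP //.
  exact: (quotient_at_root_neq0 (moment_herm c0_real Jt) (C_posdef Jt) (b_circle Jt) Pxi).
apply: (@C1C_onP _ _ J_open _ (fun t => - ((paraorth_dot n c b t).[xi t] / D t))) => t Jt.
  have [cxi Pxi] := xiP t Jt; rewrite /D ddiff_quotient ?sP //.
  apply: (@root_branch_derive _ n.+2 (fun s => P s) t (paraorth_dot n c b t) xi).
  - exact: (open_near J_open Jt sP).
  - exact: leqW (size_paraorth_dot _ _ _ _).
  - exact: (pderive_paraorth J_open c_C1 C_posdef b_C1 Jt).
  - exact: cxi.
  - by apply: (open_near J_open Jt) => s /xiP[].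
  - by have := D0 t Jt; rewrite /D ddiff_quotient ?sP.
have [cxi _] := xiP t Jt.
apply: ccontN; apply: ccontM.
  apply: (@ccont_horner _ n.+2 (fun s => paraorth_dot n c b s)).
  - by apply: (open_near J_open Jt) => s _; exact: leqW (size_paraorth_dot _ _ _ _).
  - move=> k; apply: ccont_near (C1C_ccont_cderive (CP k) Jt).
    apply: (open_near J_open Jt) => s Js.
    exact: is_cderiveE (pderive_paraorth J_open c_C1 C_posdef b_C1 Js k).
  - exact: cxi.
apply: ccontV (D0 t Jt) _; apply: (@ccont_ddiff _ _ (fun s => P s)) => //.
by move=> k; exact: cP.
Qed.

Lemma zero_branch_exists t0 z0 : J t0 -> root (P t0) z0 ->
  exists2 xi, zero_branch n c b J xi & xi t0 = z0.
Proof.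
move=> Jt0 Pz0.
have [||||xi [xi0 xiP]] := @continuous_root_branch _ J (fun t => P t) n.+1
  J_open J_itv _ _ _ _ t0 z0 Jt0 Pz0.
- by move=> t Jt; exact: monic_paraorth (C_posdef Jt) _.
- by move=> t Jt; exact: size_paraorth (C_posdef Jt) _.
- by move=> t k Jt; exact: C1C_ccont (paraorth_C1 k) Jt.
- move=> t z Jt Pz.
  exact: (quotient_at_root_neq0 (moment_herm c0_real Jt) (C_posdef Jt) (b_circle Jt) Pz).
exists xi; [exact: continuous_branch_C1 xiP|exact: xi0].
Qed.

End ZeroBranches.

Theorem theorem2p3 (R : realType) (n : nat) (J : set R)
    (c : nat -> R -> R[i]) (b : R -> R[i])
    (n_gt0 : (0 < n)%N)
    (J_open : open J) (J_itv : is_interval J)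
    (c_C1 : forall j, (j <= n)%N -> C1C_on J (c j))
    (c0_real : forall t, J t -> c 0%N t \is Num.real)
    (C_posdef : forall t, J t -> posdefmx (toeplitz (moments c t) n.+1))
    (b_C1 : C1C_on J b)
    (b_circle : forall t, J t -> `|b t| = 1) :
  [/\ [/\ forall t0 z0, J t0 -> root (paraorth n (moments c t0) (b t0)) z0 ->
            exists2 xi, zero_branch n c b J xi & xi t0 = z0,
          forall xi, zero_branch n c b J xi ->
            exists theta, C1_argument J xi theta
        & exists beta, C1_argument J b beta],
      forall (beta theta : R -> R) (xi : R -> R[i]),
        C1_argument J b beta ->
        zero_branch n c b J xi -> C1_argument J xi theta ->
        forall t, J t ->
          let a := moments c t in
          let nu := sqnorm n a (opuc a n) in
          let h := hweight n a (b t) (xi t) in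
          let V := Vfun n a (xi t) in
          [/\ 0 < h, in_Lambda n V, real_on_circle V
            & h * (derive1 theta t)%:C%C
              = - nu * (derive1 beta t)%:C%C + Ldot n c t V],
      forall (phi psi : R -> R) (zeta eta : R -> R[i]),
        zero_branch n c b J zeta -> C1_argument J zeta phi ->
        zero_branch n c b J eta -> C1_argument J eta psi ->
        (exists2 s, J s & zeta s != eta s) ->
        forall t, J t ->
          let a := moments c t in
          let B := Bfun n a (b t) (zeta t) (eta t) in
          [/\ in_Lambda n B, real_on_circle B
            & hweight n a (b t) (zeta t) * (derive1 phi t)%:C%C
              - hweight n a (b t) (eta t) * (derive1 psi t)%:C%C
              = Ldot n c t B],
      forall (f : int -> R[i]), real_on_circle (laurent n f) ->
        forall t, J t ->
          Ldot n c t (laurent n f)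
          = f 0 * cderive (c 0%N) t
            + 2 * 'Re (\sum_(1 <= j < n.+1) (f j%:Z)^* * cderive (c j) t)
    & forall k, (k <= n)%N ->
        (forall j, (j <= n)%N -> j != k ->
           forall s t, J s -> J t -> c j s = c j t) ->
        forall (f : int -> R[i]), real_on_circle (laurent n f) ->
        forall t, J t ->
          Ldot n c t (laurent n f)
          = (2 - (k == 0%N)%:R) * 'Re ((f k%:Z)^* * cderive (c k) t)].

Proof.
split.
- split=> [t0 z0 Jt0 Pz0|xi xiB|].
  + exact: zero_branch_exists.
  + apply: (C1_argument_exists J_open J_itv xiB.1) => t Jt.
    by have [] := xiB.2 t Jt.
  + exact: (C1_argument_exists J_open J_itv b_C1 b_circle).
- move=> beta theta xi bA xiB xiA t Jt a nu h V; have [xi1 Pxi] := xiB.2 t Jt.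
  have [VL VR _] := Vfun_properties J_open c_C1 c0_real C_posdef Jt xi1.
  split=> //.
  + exact: (hweight_gt0 (C_posdef t Jt) (b_circle t Jt) Pxi).
  + exact: (branch_formula J_open c_C1 c0_real C_posdef b_C1 b_circle bA xiB xiA Jt).
- move=> phi psi zeta eta zB zA eB eA _ t Jt.
  exact: (two_branches_formula J_open c_C1 c0_real C_posdef b_C1 b_circle zB zA eB eA Jt).
- by move=> f fR t Jt; apply: (Ldot_laurent J_open c_C1 c0_real fR Jt).
- move=> k kn cc f fR t Jt.
  exact: (Ldot_laurent_single J_open c_C1 c0_real kn cc fR Jt).
Qed.
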